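(* Let $F_\hbar[[G]]$ be a QFSHA and let $\mathcal F=\exp(\hbar^{-1}\phi)$ be a polar twist for $F_\hbar[[G]]$, with $\phi\in F_\hbar[[G]]^{\widetilde\otimes2}$. Set $\phi^\vee:=\hbar^{-1}\log(\mathcal F)=\hbar^{-2}\phi$, $\phi_a:=\phi-\phi_{2,1}$ and $\phi^\vee_a:=\phi^\vee-\phi^\vee_{2,1}$. Then: (a) $\phi$ is antisymmetric (i.e. $\phi_{2,1}=-\phi$) iff $\mathcal F$ is orthogonal (i.e. $\mathcal F_{2,1}=\mathcal F^{-1}$) iff $\phi^\vee$ is antisymmetric (i.e. $\phi^\vee_{2,1}=-\phi^\vee$); (b) $\mathcal F=\exp(\hbar\,\phi^\vee)$ is a twist element for the QUEA $U_\hbar(\mathfrak g^* ):=F_\hbar[[G]]^\vee$; (c) let $c:=\big((\phi_a\bmod\hbar)\ \mathrm{mod}\ (\mathfrak m^2\otimes\mathfrak m+\mathfrak m\otimes\mathfrak m^2)\big)\in\mathfrak g^*\otimes\mathfrak g^*$, with $\mathfrak m=\mathrm{Ker}(\epsilon_{F[[G]]})$ and $\mathfrak m/\mathfrak m^2=\mathfrak g^*$, be the antisymmetric twist of the Lie bialgebra $\mathfrak g^*$ attached to the polar twist $\mathcal F$ of $F_\hbar[[G]]$; and let $c^\vee:=\big(\phi^\vee_a\ \mathrm{mod}\ \hbar\,(F_\hbar[[G]]^\vee)^{\widehat\otimes2}\big)\in\mathfrak g^*\otimes\mathfrak g^*\subseteq U(\mathfrak g^* )^{\otimes2}$ be the antisymmetric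 twist of $\mathfrak g^*$ attached to the twist $\mathcal F$ of the QUEA $F_\hbar[[G]]^\vee$. Then $c=c^\vee$.
   Context: $\Bbbk$ is a field of characteristic $0$. $\widehat\otimes$ is the $\hbar$-adically completed tensor product of topologically free $\Bbbk[[\hbar]]$-modules (those $\cong V[[\hbar]]$). For topological modules $\cong\Bbbk[[\hbar]]^{E}$ with the weak (product) topology, $\widetilde\otimes$ is the completed tensor product with $\Bbbk[[\hbar]]^{E_1}\widetilde\otimes\,\Bbbk[[\hbar]]^{E_2}\cong\Bbbk[[\hbar]]^{E_1\times E_2}$. QUEA: a topologically free topological Hopf algebra $U_\hbar$ (for $\widehat\otimes$) with $U_\hbar/\hbar U_\hbar\cong U(\mathfrak a)$ as Hopf algebras for a Lie algebra $\mathfrak a$; $\mathfrak a$ becomes a Lie bialgebra via $\delta(x)=\hbar^{-1}(\Delta(x')-\Delta^{\mathrm{op}}(x'))\bmod\hbar$; one writes $U_\hbar=U_\hbar(\mathfrak a)$. QFSHA: a topological Hopf algebra $F_\hbar=F_\hbar[[G]]$ of type $\Bbbk[[\hbar]]^E$ (for $\widetilde\otimes$) with $F_\hbar/\hbar F_\hbar$ commutative and complete in the adic topology of its augmentation ideal, i.e. $\cong F[[G]]$ for a formal group $G$ (finite-dimensional here); $G$ is a formal Poisson group via $\{x,y\}=\hbar^{-1}(x'y'-y'x')\bmod\hbar$. With $\mathfrak m=\mathrm{Ker}(\epsilon_{F[[G]]})$, the cotangent Lie bialgebra is $\mathfrak g^*=\mathfrak m/\mathfrak m^2$ (bracket from the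 Poisson bracket, cobracket from $\Delta-\Delta^{\mathrm{op}}$). Drinfeld functor: $F_\hbar[[G]]^\vee$ is the $\hbar$-adic completion of $\sum_{n\ge0}\hbar^{-n}I^n$, $I=\hbar F_\hbar[[G]]+\mathrm{Ker}(\epsilon)$; it is a QUEA for $\mathfrak g^*$, the identification of $\mathfrak m/\mathfrak m^2$ with $\mathfrak g^*\subseteq U(\mathfrak g^* )=F_\hbar[[G]]^\vee/\hbar F_\hbar[[G]]^\vee$ sending the class of $f\in\mathrm{Ker}(\epsilon_{F_\hbar[[G]]})$ to $\hbar^{-1}f\bmod\hbar$. Twist for $H$: an invertible $\mathcal F\in H\otimes H$ (completed) with $(\epsilon\otimes\mathrm{id})(\mathcal F)=1=(\mathrm{id}\otimes\epsilon)(\mathcal F)$ and $\mathcal F_{12}(\Delta\otimes\mathrm{id})(\mathcal F)=\mathcal F_{23}(\mathrm{id}\otimes\Delta)(\mathcal F)$. Polar twist of $F_\hbar[[G]]$: an element $\mathcal F=\exp(\hbar^{-1}\phi)\in(F_\hbar[[G]]^\vee)^{\widehat\otimes2}$, with $\phi\in F_\hbar[[G]]^{\widetilde\otimes2}$, $(\mathrm{id}\otimes\epsilon)(\phi)=0=(\epsilon\otimes\mathrm{id})(\phi)$, having the properties of a twist for $F_\hbar[[G]]^\vee$. Known facts used to formulate (c): $c$ and $c^\vee$ are well-defined antisymmetric twists of the Lie bialgebra $\mathfrak g^*$, i.e. antisymmetric $c\in\mathfrak g^*\otimes\mathfrak g^*$ with $\mathrm{ad}_x\big((\delta\otimes\mathrm{id})(c)+\mathrm{c.p.}+[[c,c]]\big)=0$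 for all $x$, where c.p. is cyclic permutation of the previous summand and $[[c,c]]=[c_{12},c_{13}]+[c_{12},c_{23}]+[c_{13},c_{23}]$. *)

(* Defs.v *)
From HB Require Import structures.
From mathcomp Require Import all_boot all_order all_algebra.
From mathcomp Require Import mathcomp_extra boolp classical_sets functions.
From mathcomp Require Import cardinality fsbigop.

Set Implicit Arguments.
Unset Strict Implicit.
Unset Printing Implicit Defensive.

Import GRing.Theory.
Local Open Scope classical_set_scope.
Local Open Scope ring_scope.

(* Objects that are defined up to unique isomorphism (tensor products,        *)
(* quotients, completions) are given by a characteristic property of a        *)
(* candidate object, and the final statement quantifies over all candidates.  *)

(* [a n] is the coefficient of hbar^n *)
Definition hser (k : fieldType) : Type := nat -> k.

HB.instance Definition _ (k : fieldType) :=
  GRing.Zmodule.copy (hser k) (nat -> k).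

Definition hser_const (k : fieldType) (c : k) : hser k :=
  fun n => if n == 0%N then c else 0.

Definition hser_mul (k : fieldType) (a b : hser k) : hser k :=
  fun n => \sum_(i < n.+1) a i * b (n - i)%N.

Definition hser_trunc (k : fieldType) (n : nat) (a : hser k) : {poly k} :=
  \poly_(i < n) a i.

Lemma hser_mulE (k : fieldType) (n m : nat) (a b : hser k) (p q : {poly k}) :
  (m < n)%N -> (forall i, (i < n)%N -> p`_i = a i) ->
  (forall i, (i < n)%N -> q`_i = b i) -> (p * q)`_m = hser_mul a b m.
Proof.
move=> mn pa qb; rewrite coefM /hser_mul; apply: eq_bigr => i _.
rewrite pa ?qb //; first by rewrite (leq_ltn_trans (leq_subr _ _) mn).
by rewrite (leq_trans (ltn_ord i)).
Qed.

Lemma hser_truncE (k : fieldType) (n : nat) (a : hser k) i :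
  (i < n)%N -> (hser_trunc n a)`_i = a i.
Proof. by move=> lin; rewrite coef_poly lin. Qed.

Lemma hser_mulA (k : fieldType) : associative (@hser_mul k).
Proof.
move=> a b c; apply/funext => n.
set A := hser_trunc n.+1 a; set B := hser_trunc n.+1 b.
set C := hser_trunc n.+1 c.
rewrite -(@hser_mulE k n.+1 n a (hser_mul b c) A (B * C)) //.
- rewrite -(@hser_mulE k n.+1 n (hser_mul a b) c (A * B) C) ?mulrA //.
  + by move=> i lin; apply: (@hser_mulE k n.+1) => // j; exact: hser_truncE.
  + by move=> i; exact: hser_truncE.
- by move=> i; exact: hser_truncE.
- by move=> i lin; apply: (@hser_mulE k n.+1) => // j; exact: hser_truncE.
Qed.

Lemma hser_mulC (k : fieldType) : commutative (@hser_mul k).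
Proof.
move=> a b; apply/funext => n.
rewrite -(@hser_mulE k n.+1 n a b (hser_trunc n.+1 a) (hser_trunc n.+1 b)) //;
  try exact: hser_truncE.
by rewrite mulrC; apply: (@hser_mulE k n.+1) => // i; exact: hser_truncE.
Qed.

Lemma hser_mul1 (k : fieldType) : left_id (hser_const 1) (@hser_mul k).
Proof.
move=> a; apply/funext => n; rewrite /hser_mul big_ord_recl /= mul1r subn0.
by rewrite big1 ?addr0 // => i _; rewrite /hser_const /= mul0r.
Qed.

Lemma hser_mulDl (k : fieldType) :
  left_distributive (@hser_mul k) (@GRing.add (hser k)).
Proof.
move=> a b c; apply/funext => n; rewrite /hser_mul.
transitivity (\sum_(i < n.+1)
    (a i * c (n - i)%N + b i * c (n - i)%N)); last by rewrite big_split.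
by apply: eq_bigr => i _; rewrite -mulrDl.
Qed.

Lemma hser_1neq0 (k : fieldType) : hser_const (1 : k) != 0 :> hser k.
Proof.
apply/eqP => /(congr1 (fun a : hser k => a 0%N)) /eqP.
by rewrite /hser_const /= oner_eq0.
Qed.

HB.instance Definition _ (k : fieldType) :=
  GRing.Zmodule_isComNzRing.Build (hser k)
    (@hser_mulA k) (@hser_mulC k) (@hser_mul1 k) (@hser_mulDl k) (@hser_1neq0 k).

Definition hbar (k : fieldType) : hser k := fun n => (n == 1%N)%:R.
Arguments hbar {k}.

(* M is isomorphic to V[[hbar]] for some k-vector space V *)
Definition topologically_free (k : fieldType) (M : lmodType (hser k)) : Prop :=
  exists (V : lmodType k) (f : M -> nat -> V),
    [/\ bijective f,
        forall x y n, f (x + y) n = f x n + f y n &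
        forall (a : hser k) x n,
          f (a *: x) n = \sum_(i < n.+1) a i *: f x (n - i)%N].

Definition in_hbar (k : fieldType) (M : lmodType (hser k)) (N : nat) : set M :=
  [set x | exists y : M, x = hbar ^+ N *: y].

(* hbar^-n x; the element y is unique when M has no hbar-torsion *)
Definition hdiv (k : fieldType) (M : lmodType (hser k)) (n : nat) (x : M) : M :=
  xget 0 [set y | hbar ^+ n *: y = x].

Definition hlim (k : fieldType) (M : lmodType (hser k)) (u : nat -> M) : M :=
  xget 0 [set l | forall N, exists n0, forall n, (n0 <= n)%N ->
    in_hbar N (u n - l)].

Definition hexp (k : fieldType) (A : algType (hser k)) (x : A) : A :=
  hlim (fun n => \sum_(i < n) hser_const ((i`!)%:R^-1 : k) *: x ^+ i).

Definition hlog (k : fieldType) (A : algType (hser k)) (x : A) : A :=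
  hlim (fun n =>
    \sum_(1 <= i < n) hser_const ((-1) ^+ i.+1 / i%:R : k) *: (x - 1) ^+ i).

Definition bilinear_map (R : pzRingType) (M N P : lmodType R)
  (b : M -> N -> P) : Prop :=
  (forall y, linear (b^~ y)) /\ (forall x, linear (b x)).

(* (T, t) is the hbar-adically completed tensor product of M and N.  Every    *)
(* k[[hbar]]-linear map is hbar-adically continuous, and topologically free   *)
(* modules are complete and separated, so maps from the completion of the     *)
(* algebraic tensor product to P are just bilinear maps to P.                 *)
Definition is_completed_tensor (k : fieldType) (M N T : lmodType (hser k))
  (t : M -> N -> T) : Prop :=
  [/\ topologically_free T, bilinear_map t &
      forall (P : lmodType (hser k)) (b : M -> N -> P),
        topologically_free P -> bilinear_map b ->
        exists! f : T -> P, linear f /\ forall x y, f (t x y) = b x y].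

Definition tensor_lift (k : fieldType) (M N T P : lmodType (hser k))
  (t : M -> N -> T) (b : M -> N -> P) : T -> P :=
  xget (fun _ => 0) [set f | linear f /\ forall x y, f (t x y) = b x y].

Section CompletedTensorPowers.
Variables (k : fieldType) (H H2 H3 : algType (hser k)).
Variables (t2 : H -> H -> H2) (t3 : H2 -> H -> H3).

Definition tens_r (x : H) : H2 -> H3 :=
  tensor_lift t2 (fun y z => t3 (t2 x y) z).

Definition cop_l (D : H -> H2) : H2 -> H3 :=
  tensor_lift t2 (fun x y => t3 (D x) y).

Definition cop_r (D : H -> H2) : H2 -> H3 :=
  tensor_lift t2 (fun x y => tens_r x (D y)).

Definition cou_l (e : H -> (hser k)^o) : H2 -> H :=
  tensor_lift t2 (fun x y => e x *: y).

Definition cou_r (e : H -> (hser k)^o) : H2 -> H :=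
  tensor_lift t2 (fun x y => e y *: x).

Definition flip2 : H2 -> H2 := tensor_lift t2 (fun x y => t2 y x).

End CompletedTensorPowers.

(* hH2 and hH3 are the second and third completed tensor powers of hH *)
Record hHopf (k : fieldType) := HHopf {
  hH : algType (hser k);
  hH2 : algType (hser k);
  hH3 : algType (hser k);
  ht2 : hH -> hH -> hH2;
  ht3 : hH2 -> hH -> hH3;
  hcop : {lrmorphism hH -> hH2};
  hcou : {lrmorphism hH -> (hser k)^o};
  hant : {linear hH -> hH};
  hfree : topologically_free hH;
  ht2P : is_completed_tensor ht2;
  ht3P : is_completed_tensor ht3;
  ht2_1 : ht2 1 1 = 1;
  ht2_M : forall x y x' y', ht2 x y * ht2 x' y' = ht2 (x * x') (y * y');
  ht3_1 : ht3 1 1 = 1;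
  ht3_M : forall x y x' y', ht3 x y * ht3 x' y' = ht3 (x * x') (y * y');
  hcopA : forall x,
    cop_l ht2 ht3 hcop (hcop x) = cop_r ht2 ht3 hcop (hcop x);
  hcou_lP : forall x, cou_l ht2 hcou (hcop x) = x;
  hcou_rP : forall x, cou_r ht2 hcou (hcop x) = x;
  hant_lP : forall x,
    tensor_lift ht2 (fun y z => hant y * z) (hcop x) = hcou x *: 1;
  hant_rP : forall x,
    tensor_lift ht2 (fun y z => y * hant z) (hcop x) = hcou x *: 1 }.

Arguments ht2 {k} h.
Arguments ht3 {k} h.
Arguments hcop {k} h.
Arguments hcou {k} h.
Arguments hant {k} h.

Definition hflip (k : fieldType) (U : hHopf k) : hH2 U -> hH2 U :=
  flip2 (ht2 U).

Definition is_inverse (R : pzRingType) (x y : R) : Prop :=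
  x * y = 1 /\ y * x = 1.

Definition is_twist (k : fieldType) (U : hHopf k) (x : hH2 U) : Prop :=
  [/\ exists y, is_inverse x y,
      cou_l (ht2 U) (hcou U) x = 1,
      cou_r (ht2 U) (hcou U) x = 1 &
      ht3 U x 1 * cop_l (ht2 U) (ht3 U) (hcop U) x =
      tens_r (ht2 U) (ht3 U) 1 x
        * cop_r (ht2 U) (ht3 U) (hcop U) x].

Notation wprod k E := (E -> (hser k)^o).
Notation kprod k E := (E -> k^o).

(* Neighbourhoods of 0 for: the hbar-adic topology, the product over E of the *)
(* hbar-adic topologies, and the product over E of discrete topologies on k.  *)
Definition hbar_nbhs0 (k : fieldType) (M : lmodType (hser k)) : set (set M) :=
  [set W | exists N, in_hbar N `<=` W].

Definition weak_nbhs0 (k : fieldType) (E : Type) : set (set (wprod k E)) :=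
  [set W | exists (A : set E) (N : nat), finite_set A /\
     [set u : wprod k E | forall e, A e -> in_hbar N (u e)] `<=` W].

Definition kweak_nbhs0 (k : fieldType) (E : Type) : set (set (kprod k E)) :=
  [set W | exists A : set E, finite_set A /\
     [set u : kprod k E | forall e, A e -> u e = 0] `<=` W].

(* continuity of an additive map, with respect to neighbourhoods of 0 *)
Definition continuous0 (X Y : Type) (nX : set (set X)) (nY : set (set Y))
  (f : X -> Y) : Prop := forall W, nY W -> nX (f @^-1` W).

Definition wtens (R : pzRingType) (X Y : Type) (u : X -> R^o) (v : Y -> R^o) :
  X * Y -> R^o := fun p => (u p.1 : R) * v p.2.

Definition wflip (R : Type) (X : Type) (u : X * X -> R) : X * X -> R :=
  fun p => u (p.2, p.1).

(* f (x) id and id (x) f, with R^(X * Z) read as the Z-indexed families of    *)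
(* elements of R^X (resp. R^(Z * X) as the Z-indexed families)                *)
Definition wmap_l (R X Y Z : Type) (f : (X -> R) -> (Y -> R))
  (u : X * Z -> R) : Y * Z -> R := fun p => f (fun x => u (x, p.2)) p.1.

Definition wmap_r (R X Y Z : Type) (f : (X -> R) -> (Y -> R))
  (u : Z * X -> R) : Z * Y -> R := fun p => f (fun x => u (p.1, x)) p.2.

(* product of the completed tensor square: (m (x) m) o tau_23 *)
Definition wmul2 (k : fieldType) (E : Type)
  (m : wprod k (E * E) -> wprod k E) (u v : wprod k (E * E)) :
  wprod k (E * E) :=
  wmap_l m (wmap_r m (fun p : (E * E) * (E * E) =>
    (u (p.1.1, p.2.1) : hser k) * v (p.1.2, p.2.2))).

Record wHopf (k : fieldType) := WHopf {
  wE : Type;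
  wmul : {linear wprod k (wE * wE) -> wprod k wE};
  wone : wprod k wE;
  wcop : {linear wprod k wE -> wprod k (wE * wE)};
  wcou : {linear wprod k wE -> (hser k)^o};
  want : {linear wprod k wE -> wprod k wE};
  wmul_cont : continuous0 (weak_nbhs0 (k:=k) (E:=_)) (weak_nbhs0 (E:=_)) wmul;
  wcop_cont : continuous0 (weak_nbhs0 (k:=k) (E:=_)) (weak_nbhs0 (E:=_)) wcop;
  wcou_cont :
    continuous0 (weak_nbhs0 (k:=k) (E:=_)) (hbar_nbhs0 (M:=_)) wcou;
  want_cont : continuous0 (weak_nbhs0 (k:=k) (E:=_)) (weak_nbhs0 (E:=_)) want;
  wmulA : forall x y z,
    wmul (wtens x (wmul (wtens y z))) = wmul (wtens (wmul (wtens x y)) z);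
  wmul1l : forall x, wmul (wtens wone x) = x;
  wmul1r : forall x, wmul (wtens x wone) = x;
  wcopA : forall x e1 e2 e3,
    wmap_l wcop (wcop x) ((e1, e2), e3) = wmap_r wcop (wcop x) (e1, (e2, e3));
  wcou_l : forall x e, wcou (fun e' => wcop x (e', e)) = x e;
  wcou_r : forall x e, wcou (fun e' => wcop x (e, e')) = x e;
  wcopM : forall x y, wcop (wmul (wtens x y)) = wmul2 wmul (wcop x) (wcop y);
  wcop1 : wcop wone = wtens wone wone;
  wcouM : forall x y, wcou (wmul (wtens x y)) = (wcou x : hser k) * wcou y;
  wcou1 : wcou wone = (1 : hser k);
  want_l : forall x, wmul (wmap_l want (wcop x)) = wcou x *: wone;
  want_r : forall x, wmul (wmap_r want (wcop x)) = wcou x *: wone }.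

Arguments wmul {k} w.
Arguments wone {k} w.
Arguments wcop {k} w.
Arguments wcou {k} w.
Arguments want {k} w.

Notation wF k F := (wprod k (wE F)).
Notation wF2 k F := (wprod k (wE F * wE F)).

(* k[[hbar]]^E / hbar k[[hbar]]^E is k^E, the class of u being [modh u] *)
Definition modh (k : fieldType) (E : Type) (u : wprod k E) : kprod k E :=
  fun e => u e 0%N.

Definition lifth (k : fieldType) (E : Type) (u : kprod k E) : wprod k E :=
  fun e => hser_const (u e).

Section Reduction.
Variables (k : fieldType) (F : wHopf k).

Definition mul0 (x y : kprod k (wE F)) : kprod k (wE F) :=
  modh (wmul F (wtens (lifth x) (lifth y))).

Definition one0 : kprod k (wE F) := modh (wone F).

(* the augmentation ideal of F / hbar F, and its square *)
Definition max_ideal : set (kprod k (wE F)) :=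
  [set x | wcou F (lifth x) 0%N = 0].

Definition max_ideal2 : set (kprod k (wE F)) :=
  [set x | exists s : seq (kprod k (wE F) * kprod k (wE F)),
     (forall p, p \in s -> max_ideal p.1 /\ max_ideal p.2) /\
     x = \sum_(p <- s) mul0 p.1 p.2].

(* Inside the completed tensor square of F / hbar F: m^2 (x) m + m (x) m^2,   *)
(* the tensor products of subspaces being completed ones, that is, the        *)
(* closure of the span of the pure tensors                                    *)
Definition max_ideal_deg3 : set (kprod k (wE F * wE F)) :=
  [set x | forall A : set (wE F * wE F), finite_set A ->
     exists s : seq (kprod k (wE F) * kprod k (wE F)),
       (forall p, p \in s -> (max_ideal2 p.1 /\ max_ideal p.2) \/
                             (max_ideal p.1 /\ max_ideal2 p.2)) /\
       forall e, A e -> x e = (\sum_(p <- s) wtens p.1 p.2) e].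

End Reduction.

Arguments mul0 {k} F x y.
Arguments one0 {k} F.
Arguments max_ideal {k} F.
Arguments max_ideal2 {k} F.
Arguments max_ideal_deg3 {k} F.

(* k[[x_1, ..., x_d]]: families of coefficients indexed by multi-exponents *)
Notation pseries k d := (kprod k {ffun 'I_d -> nat}).

Definition pseries_mul (k : fieldType) (d : nat) (f g : pseries k d) :
  pseries k d :=
  fun a => \sum_(b \in [set b : {ffun 'I_d -> nat} | forall i, (b i <= a i)%N])
    (f b : k) * g [ffun i => (a i - b i)%N].

Definition pseries_one (k : fieldType) (d : nat) : pseries k d :=
  fun a => if a == [ffun => 0%N] then 1 else 0.

(* F / hbar F is isomorphic, as a topological algebra, to the algebra         *)
(* k[[x_1, ..., x_d]] of functions on a d-dimensional formal group; the       *)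
(* augmentation ideal is then the maximal ideal.                              *)
Definition is_QFSHA (k : fieldType) (F : wHopf k) : Prop :=
  exists (d : nat) (theta : {linear pseries k d -> kprod k (wE F)}),
    [/\ bijective theta,
        forall W, kweak_nbhs0 W <-> kweak_nbhs0 (theta @^-1` W),
        theta (@pseries_one k d) = one0 F &
        forall f g, theta (pseries_mul f g) = mul0 F (theta f) (theta g)].

(* I = hbar F + Ker(epsilon) *)
Definition aug_ideal (k : fieldType) (F : wHopf k) : set (wF k F) :=
  [set x | exists y z, wcou F z = 0 /\ x = hbar *: y + z].

Fixpoint aug_ideal_pow (k : fieldType) (F : wHopf k) (n : nat) : set (wF k F) :=
  if n is n'.+1 then
    [set x | exists s : seq (wF k F * wF k F),
       (forall p, p \in s -> aug_ideal p.1 /\ aug_ideal_pow n' p.2) /\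
       x = \sum_(p <- s) wmul F (wtens p.1 p.2)]
  else setT.

(* U, with iota : F -> U, is the hbar-adic completion of the algebra          *)
(*   S := \sum_n hbar^-n I^n, a subalgebra of F[1/hbar],                      *)
(* with the Hopf structure extending the one of F, and j is the canonical map *)
(* from the (weakly completed) tensor square of F to the (hbar-adically       *)
(* completed) one of U.  As hbar is in I, the sum S is the increasing union   *)
(* of the hbar^-n I^n, so that an element of S is hbar^-n x with x in I^n.    *)
(* - dr_dom says that iota extends to S;                                      *)
(* - dr_dense and dr_sep say that S / hbar^N S -> U / hbar^N U is onto, and   *)
(*   one-to-one, for all N; together with the completeness of U (contained in *)
(*   hHopf) this makes U the completion of S.                                 *)
(* In dr_sep, the last equation is hbar^-n x = hbar^N (hbar^-m y) in S.       *)
Record is_Drinfeld_dual (k : fieldType) (F : wHopf k) (U : hHopf k)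
  (iota : {linear wF k F -> hH U}) (j : {linear wF2 k F -> hH2 U}) : Prop := {
  dr_one : iota (wone F) = 1;
  dr_mul : forall x y, iota (wmul F (wtens x y)) = iota x * iota y;
  dr_dom : forall n x, aug_ideal_pow n x -> in_hbar n (iota x);
  dr_dense : forall (u : hH U) N, exists n x,
    aug_ideal_pow n x /\ in_hbar N (u - hdiv n (iota x));
  dr_sep : forall n x N,
    aug_ideal_pow n x -> in_hbar N (hdiv n (iota x)) ->
    exists m y, aug_ideal_pow m y /\ hbar ^+ m *: x = hbar ^+ (n + N) *: y;
  dr_j_tens : forall x y, j (wtens x y) = ht2 U (iota x) (iota y);
  dr_j_cont : continuous0 (weak_nbhs0 (k:=k) (E:=_)) (hbar_nbhs0 (M:=_)) j;
  dr_cop : forall x, hcop U (iota x) = j (wcop F x);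
  dr_cou : forall x, hcou U (iota x) = wcou F x;
  dr_ant : forall x, hant U (iota x) = iota (want F x) }.

Definition polar_exp (k : fieldType) (F : wHopf k) (U : hHopf k)
  (j : wF2 k F -> hH2 U) (phi : wF2 k F) : hH2 U := hexp (hdiv 1 (j phi)).

Definition is_polar_twist (k : fieldType) (F : wHopf k) (U : hHopf k)
  (j : wF2 k F -> hH2 U) (phi : wF2 k F) : Prop :=
  [/\ forall e, wcou F (fun e' => phi (e, e')) = 0,
      forall e, wcou F (fun e' => phi (e', e)) = 0 &
      is_twist (polar_exp j phi)].

(* g, with the restriction to m of p, is the quotient m / m^2 *)
Definition is_cotangent (k : fieldType) (F : wHopf k) (g : lmodType k)
  (p : {linear kprod k (wE F) -> g}) : Prop :=
  (forall v, exists x, max_ideal F x /\ p x = v) /\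
  (forall x, max_ideal F x -> (p x = 0 <-> max_ideal2 F x)).

Definition is_tensor (k : fieldType) (V W T : lmodType k) (t : V -> W -> T) :
  Prop :=
  bilinear_map t /\
  forall (P : lmodType k) (b : V -> W -> P), bilinear_map b ->
    exists! f : T -> P, linear f /\ forall x y, f (t x y) = b x y.

Section CotangentElements.
Variables (k : fieldType) (F : wHopf k) (U : hHopf k).
Variables (iota : {linear wF k F -> hH U}).
Variables (g gg : lmodType k) (p : {linear kprod k (wE F) -> g}).
Variables (tg : g -> g -> gg).

(* c, in g (x) g = (m (x) m) / (m^2 (x) m + m (x) m^2), is the class of x *)
Definition is_class_mod_deg3 (x : kprod k (wE F * wE F)) (c : gg) : Prop :=
  exists s : seq (kprod k (wE F) * kprod k (wE F)),
    [/\ forall q, q \in s -> max_ideal F q.1 /\ max_ideal F q.2,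
        c = \sum_(q <- s) tg (p q.1) (p q.2) &
        max_ideal_deg3 F (x - \sum_(q <- s) wtens q.1 q.2)].

(* c, in g (x) g contained in (U / hbar U) (x) (U / hbar U), is the class of  *)
(* u modulo hbar; g is embedded in U / hbar U by sending the class of f in    *)
(* Ker(epsilon) to the class of hbar^-1 f                                     *)
Definition is_class_modh (u : hH2 U) (c : gg) : Prop :=
  exists s : seq (wF k F * wF k F),
    [/\ forall q, q \in s -> wcou F q.1 = 0 /\ wcou F q.2 = 0,
        c = \sum_(q <- s) tg (p (modh q.1)) (p (modh q.2)) &
        in_hbar 1 (u - \sum_(q <- s)
          ht2 U (hdiv 1 (iota q.1)) (hdiv 1 (iota q.2)))].

End CotangentElements.

(* Main.v *)
(* Write J = Ker(eps), I = hbar F + J, and let X_1, ..., X_d in J lift the    *)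
(* coordinates of F / hbar F = k[[x]]. As F is commutative modulo hbar,       *)
(* swapping two factors in a product of n elements of J changes it by an      *)
(* element of hbar J^(n-1), so that J^n is spanned by the ordered monomials   *)
(* of degree n modulo hbar I^(n-1) + J^(n+1). Together with J^n -> 0 in the   *)
(* weak topology, this shows that if hbar^m x is in I^(m+n), then x modulo    *)
(* hbar has order at least n; hence so does every x in F whose image lies in  *)
(* hbar^n U. Thus F -> U is injective, and the hbar^-1 X_i are linearly       *)
(* independent in U / hbar U. Contracting one tensor factor by linear forms   *)
(* on U carries both facts over to the tensor squares.                        *)
(*                                                                            *)
(* By density, an element of F (x) F killed by eps on both sides is a sum of  *)
(* tensors of J (x) J up to an arbitrarily small term, so it maps into hbar^2 *)
(* (U (x) U). For phi this makes hbar^-1 phi divisible by hbar, whence        *)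
(* log(exp(hbar^-1 phi)) = hbar^-1 phi, and (a) follows as j is injective and *)
(* commutes with the flips. For phi_a the same finite sum of tensors computes *)
(* both c and c^vee, and both are determined by the coefficients of the x_a   *)
(* (x) x_b.                                                                   *)

Require Import Defs.
From HB Require Import structures.
From mathcomp Require Import all_boot all_order all_algebra.
From mathcomp Require Import mathcomp_extra boolp classical_sets functions.
From mathcomp Require Import cardinality fsbigop.
From mathcomp Require Import ring zify.

Set Implicit Arguments.
Unset Strict Implicit.
Unset Printing Implicit Defensive.

Import GRing.Theory.
Local Open Scope classical_set_scope.
Local Open Scope ring_scope.

(** The hypothesis that eps kills phi on both sides gives, by [j_aug], an element psi with j phi =
    hbar^2 psi. Thus the twist is exp(hbar psi), where the exponent is divisible by hbar; logarithm
    undoes exponential ([hexpK]), so phi^vee = psi and (b) is immediate. For (a), the flip is an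
    algebra morphism and commutes with the exponential ([hexp_morph]), and the inverse of exp(hbar
    psi) is exp(- hbar psi) ([hexpN]); hence orthogonality says that psi is antisymmetric. This
    passes to phi through [j_flip] and [j_inj].

    For (c), both classes are read from the matrix of coefficients of the x_a (x) x_b
    ([common_class]). On the side of F these are the continuous forms [lin2]; on the side of U they
    are well defined because the hbar^-1 X_a (x) hbar^-1 X_b are independent modulo hbar
    ([hvar2_free]).

    Injectivity and independence both come from [iota_order]: the map F -> U creates no more
    divisibility by hbar than the order modulo hbar allows. This is a statement of
    Poincare-Birkhoff-Witt type. Its core is [jpow_next], which trades order modulo hbar for
    divisibility, and [ipow_closureS], which cancels one hbar in the weak closures of the powers of
    I. *)

Section Hser.
Variable k : fieldType.
Implicit Types (a b : hser k) (c : k).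

Lemma hserD a b n : (a + b) n = a n + b n. Proof. by []. Qed.
Lemma hserN a n : (- a) n = - a n. Proof. by []. Qed.
Lemma hserM a b n : (a * b) n = \sum_(i < n.+1) a i * b (n - i)%N.
Proof. by []. Qed.
Lemma hser1 n : (1 : hser k) n = if n == 0%N then 1 else 0. Proof. by []. Qed.

Lemma hserM0 a b : (a * b) 0%N = a 0%N * b 0%N.
Proof. by rewrite hserM big_ord1. Qed.

Lemma hser_constM c a n : (hser_const c * a) n = c * a n.
Proof.
rewrite hserM big_ord_recl big1 ?addr0 ?subn0 // => i _.
by rewrite /hser_const /= mul0r.
Qed.

Lemma hser_const_is_zmod_morphism : zmod_morphism (@hser_const k).
Proof.
by move=> c d; apply/funext=> -[|n]; rewrite hserD hserN /hser_const //= subr0.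
Qed.

HB.instance Definition _ := GRing.isZmodMorphism.Build k (hser k)
  (@hser_const k) hser_const_is_zmod_morphism.

Lemma hser_const_is_monoid_morphism : monoid_morphism (@hser_const k).
Proof.
split=> // c d; apply/funext=> n; rewrite hser_constM /hser_const.
by case: eqP => //; rewrite mulr0.
Qed.

HB.instance Definition _ := GRing.isMonoidMorphism.Build k (hser k)
  (@hser_const k) hser_const_is_monoid_morphism.

Lemma hbarM a n : (hbar * a) n = if n is m.+1 then a m else 0.
Proof.
case: n => [|n]; first by rewrite hserM0 mul0r.
rewrite hserM big_ord_recl big_ord_recl /= mul0r add0r mul1r subSS subn0.
by rewrite big1 ?addr0 // => i _; rewrite mul0r.
Qed.

Lemma hbarXM N a n : (hbar ^+ N * a) n = if (n < N)%N then 0 else a (n - N)%N.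
Proof.
elim: N n => [|N IH] n; first by rewrite expr0 mul1r subn0.
by rewrite exprS -mulrA hbarM; case: n => [|n] //; rewrite IH ltnS subSS.
Qed.

Lemma hbarX N n : (hbar ^+ N : hser k) n = (n == N)%:R.
Proof.
rewrite -[_ ^+ _]mulr1 hbarXM hser1 subn_eq0 eqn_leq.
by case: ltngtP.
Qed.

End Hser.

(** * Divisibility by hbar, division and limits in modules over k[[hbar]] *)

Section Hbar.
Variable k : fieldType.

Section Module.
Variable M : lmodType (hser k).
Implicit Types x y : M.

Lemma in_hbar00 x : in_hbar 0 x.
Proof. by exists x; rewrite expr0 scale1r. Qed.

Lemma in_hbar0 N : in_hbar N (0 : M).
Proof. by exists 0; rewrite scaler0. Qed.

Lemma in_hbarD N x y : in_hbar N x -> in_hbar N y -> in_hbar N (x + y).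
Proof. by move=> [u ->] [v ->]; exists (u + v); rewrite scalerDr. Qed.

Lemma in_hbarN N x : in_hbar N x -> in_hbar N (- x).
Proof. by move=> [u ->]; exists (- u); rewrite scalerN. Qed.

Lemma in_hbarB N x y : in_hbar N x -> in_hbar N y -> in_hbar N (x - y).
Proof. by move=> hx hy; apply: in_hbarD => //; exact: in_hbarN. Qed.

Lemma in_hbarBC N x y : in_hbar N (x - y) -> in_hbar N (y - x).
Proof. by move/in_hbarN; rewrite opprB. Qed.

Lemma in_hbarB_trans N x y z :
  in_hbar N (x - y) -> in_hbar N (y - z) -> in_hbar N (x - z).
Proof. by move=> hx hy; rewrite -(subrKA y); exact: in_hbarD. Qed.

Lemma in_hbarZ N (a : hser k) x : in_hbar N x -> in_hbar N (a *: x).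
Proof. by move=> [u ->]; exists (a *: u); rewrite !scalerA mulrC. Qed.

Lemma in_hbar_scale N m x : in_hbar N x -> in_hbar (m + N) (hbar ^+ m *: x).
Proof. by move=> [u ->]; exists u; rewrite scalerA exprD. Qed.

Lemma in_hbar_hbar N x : in_hbar N (hbar ^+ N *: x).
Proof. by exists x. Qed.

Lemma in_hbarW N m x : (m <= N)%N -> in_hbar N x -> in_hbar m x.
Proof.
move=> mN [u ->]; exists (hbar ^+ (N - m) *: u).
by rewrite scalerA -exprD subnKC.
Qed.

Lemma in_hbar_sum N (I : Type) (s : seq I) (P : pred I) (u : I -> M) :
  (forall i, P i -> in_hbar N (u i)) -> in_hbar N (\sum_(i <- s | P i) u i).
Proof. by move=> h; elim/big_ind: _ => //; [exact: in_hbar0|exact: in_hbarD]. Qed.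

Lemma in_hbar_sum_seq N (I : eqType) (s : seq I) (u : I -> M) :
  (forall i, i \in s -> in_hbar N (u i)) -> in_hbar N (\sum_(i <- s) u i).
Proof. by move=> h; rewrite big_seq; apply: in_hbar_sum. Qed.

End Module.

Lemma in_hbar_linear (M M' : lmodType (hser k)) (f : M -> M') N x :
  linear f -> in_hbar N x -> in_hbar N (f x).
Proof.
move=> lf [u ->]; exists (f u).
have f0 : f 0 = 0.
  have := lf 1 0 0; rewrite !scale1r addr0 => /(congr1 (fun z => z - f 0)).
  by rewrite addrK subrr.
by have := lf (hbar ^+ N) u 0; rewrite f0 !addr0.
Qed.

Section Algebra.
Variable H : algType (hser k).
Implicit Types x y : H.

Lemma in_hbarM N m x y : in_hbar N x -> in_hbar m y -> in_hbar (N + m) (x * y).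
Proof.
move=> [u ->] [v ->]; exists (u * v).
by rewrite -scalerAl -scalerAr scalerA exprD.
Qed.

Lemma in_hbarMl N x y : in_hbar N y -> in_hbar N (x * y).
Proof. exact: (@in_hbarM 0 N x y (in_hbar00 x)). Qed.

Lemma in_hbarMr N x y : in_hbar N x -> in_hbar N (x * y).
Proof. by move=> hx; rewrite -[N]addn0; exact: in_hbarM hx (in_hbar00 y). Qed.

Lemma in_hbarX n x : in_hbar 1 x -> in_hbar n (x ^+ n).
Proof.
move=> hx; elim: n => [|n IH]; first exact: in_hbar00.
by rewrite exprS -add1n; exact: in_hbarM.
Qed.

Lemma in_hbar_subX N x y n : in_hbar N (x - y) -> in_hbar N (x ^+ n - y ^+ n).
Proof.
move=> hxy; elim: n => [|n IH]; first by rewrite subrr; exact: in_hbar0.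
rewrite !exprS.
have -> : x * x ^+ n - y * y ^+ n = (x - y) * x ^+ n + y * (x ^+ n - y ^+ n).
  by rewrite mulrBl mulrBr addrA subrK.
by apply: in_hbarD; [exact: in_hbarMr|exact: in_hbarMl].
Qed.

End Algebra.

Section Free.
Variable M : lmodType (hser k).
Hypothesis freeM : topologically_free M.
Implicit Types x y : M.

(** In coefficient sequences hbar acts as a shift, so absence of torsion, separatedness and
    completeness can all be read off coefficientwise. *)
Lemma free_coordinates : exists (V : lmodType k) (f : M -> nat -> V),
  [/\ bijective f,
      forall (a : hser k) x y n, f (a *: x + y) n =
        \sum_(i < n.+1) a i *: f x (n - i)%N + f y n,
      forall N x n, f (hbar ^+ N *: x) n =
        if (n < N)%N then 0 else f x (n - N)%N &
      forall N x, in_hbar N x <-> forall n, (n < N)%N -> f x n = 0].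
Proof.
have [V [f [fbij fD fZ]]] := freeM; exists V, f.
have fX N x n : f (hbar ^+ N *: x) n = if (n < N)%N then 0 else f x (n - N)%N.
  rewrite fZ; case: ltnP => nN.
    rewrite big1 // => i _; rewrite hbarX eqn_leq.
    by rewrite [(N <= i)%N]leqNgt (leq_trans (ltn_ord i) nN) andbF scale0r.
  rewrite (bigD1 (Ordinal (nN : (N < n.+1)%N))) //= hbarX eqxx scale1r.
  rewrite big1 ?addr0 // => i; rewrite -val_eqE /= hbarX => /negPf ->.
  by rewrite scale0r.
split=> //; first by move=> a x y n; rewrite fD fZ.
move=> N x; split=> [[y ->] n nN|x0]; first by rewrite fX nN.
have [g fK gK] := fbij; exists (g (fun n => f x (n + N)%N)).
apply: (bij_inj fbij); apply/funext => n; rewrite fX gK.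
by case: ltnP => nN; [exact: x0|rewrite subnK].
Qed.

Lemma hbar_inj N x y : hbar ^+ N *: x = hbar ^+ N *: y -> x = y.
Proof.
have [V [f [fbij _ fX _]]] := free_coordinates.
move=> exy; apply: (bij_inj fbij); apply/funext => n.
have := congr1 (fun z => f z (n + N)%N) exy.
by rewrite !fX ltnNge leq_addl /= addnK.
Qed.

Lemma hbar1_inj x y : hbar *: x = hbar *: y -> x = y.
Proof. exact: (@hbar_inj 1). Qed.

Lemma in_hbar_cancel N m x : in_hbar (m + N) (hbar ^+ m *: x) -> in_hbar N x.
Proof.
by move=> [y]; rewrite exprD -scalerA => /hbar_inj ->; exact: in_hbar_hbar.
Qed.

Lemma in_hbar_eq0 x : (forall N, in_hbar N x) -> x = 0.
Proof.
have [V [f [fbij fl _ fin]]] := free_coordinates.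
move=> hx; apply: (bij_inj fbij); apply/funext => n.
have /fin-> // := hx n.+1; symmetry.
by have /(fin n.+1)-> := in_hbar0 M n.+1.
Qed.

Lemma in_hbar_eq x y : (forall N, in_hbar N (x - y)) -> x = y.
Proof. by move=> /in_hbar_eq0 /eqP; rewrite subr_eq0 => /eqP. Qed.

Lemma hdivE N x y : hbar ^+ N *: y = x -> hdiv N x = y.
Proof.
move=> e; rewrite /hdiv; case: xgetP => [z _ /= ez|/(_ y)]; last by case.
by apply: (@hbar_inj N); rewrite ez e.
Qed.

Lemma hdivK N x : in_hbar N x -> hbar ^+ N *: hdiv N x = x.
Proof. by move=> [y e]; rewrite (@hdivE N x y). Qed.

(** [hlim] chooses some limit; separatedness leaves only one choice. *)
Lemma hlimE (u : nat -> M) l :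
  (forall N, exists n0, forall n, (n0 <= n)%N -> in_hbar N (u n - l)) ->
  hlim u = l.
Proof.
move=> ul; rewrite /hlim; case: xgetP => [z _ /= uz|/(_ l)]; last by case.
apply: in_hbar_eq => N; have [n0 h0] := ul N; have [n1 h1] := uz N.
apply: (@in_hbarB_trans _ _ _ (u (maxn n0 n1))).
  by apply/in_hbarBC/h1; exact: leq_maxr.
by apply/h0; exact: leq_maxl.
Qed.

(** Completeness with an explicit rate: the coefficient of hbar^n no longer changes from the partial
    sum of n+1 terms on, and the limit collects these stable coefficients. *)
Lemma series_limit (t : nat -> M) : (forall n, in_hbar n (t n)) ->
  exists l, forall n, in_hbar n (\sum_(i < n) t i - l).
Proof.
have [V [f [fbij fl _ fin]]] := free_coordinates.
have [g fK gK] := fbij.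
move=> ht; pose S n := \sum_(i < n) t i.
have fB x y n : f (x - y) n = f x n - f y n.
  rewrite -[x - y]addrC -scaleN1r fl addrC big_ord_recl /= subn0.
  rewrite hserN hser1 /= scaleN1r big1 ?addr0 // => i _.
  by rewrite hserN hser1 oppr0 scale0r.
have S_stable n m : (n <= m)%N -> in_hbar n (S m - S n).
  move=> nm; rewrite /S -!(big_mkord xpredT t).
  rewrite (big_cat_nat (n := n)) //= addrAC subrr add0r big_seq.
  apply: in_hbar_sum => i; rewrite mem_index_iota => /andP[ni _].
  exact: in_hbarW ni (ht i).
exists (g (fun n => f (S n.+1) n)) => n; apply/fin => m mn.
rewrite fB gK -fB.
exact: ((fin m.+1 _).1 (S_stable _ _ mn)).
Qed.

End Free.
End Hbar.

(** * Exponential and logarithm *)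

Section TruncatedExpLog.
Variable k : fieldType.
Hypothesis char0 : [pchar k] =i pred0.

Definition exp_poly n : {poly k} := \poly_(i < n) (i`!)%:R^-1.
Definition log_poly n : {poly k} :=
  \poly_(i < n) (if i == 0%N then 0 else (-1) ^+ i.+1 / i%:R).

Lemma natf_neq0_char0 n : n.+1%:R != 0 :> k.
Proof. by have /pcharf0P -> := char0. Qed.

Lemma deriv_exp_poly n : (exp_poly n.+1)^`() = exp_poly n.
Proof.
apply/polyP => i; rewrite coef_deriv !coef_poly ltnS; case: ltnP => _.
  by rewrite factS natrM invfM -mulrnAl -[_^-1 *+ _]mulr_natr mulVf ?mul1r
     ?natf_neq0_char0.
by rewrite mul0rn.
Qed.

Lemma exp_polyS n : exp_poly n = exp_poly n.+1 - (n`!)%:R^-1 *: 'X^n.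
Proof.
apply/polyP => i; rewrite coefB coefZ coefXn !coef_poly ltnS.
by case: ltngtP => [| |->]; rewrite ?mulr0 ?subr0 ?mulr1 ?subrr.
Qed.

Lemma exp_poly0 n : (exp_poly n.+1)`_0 = 1.
Proof. by rewrite coef_poly fact0 invr1. Qed.

Lemma deriv_log_poly n :
  (1 + 'X) * (log_poly n.+1)^`() = 1 - (- 'X) ^+ n :> {poly k}.
Proof.
have -> : (log_poly n.+1)^`() = \sum_(i < n) (- 'X) ^+ i.
  rewrite (eq_bigr (fun i : 'I_n => (-1) ^+ i *: 'X^i)); last first.
    by move=> i _; rewrite -mul_polyC rmorphXn /= polyCN polyC1 -exprNn.
  rewrite -poly_def; apply/polyP => i; rewrite coef_deriv !coef_poly ltnS.
  case: ltnP => _; last by rewrite mul0rn.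
  by rewrite /= -[_ / _ *+ _]mulr_natr divfK ?natf_neq0_char0 // !exprS !mulN1r opprK.
by rewrite -[RHS]opprB subrX1 -mulNr opprB opprK.
Qed.

(** Truncated identities are proved by comparing constant terms and derivatives; integrating divides
    by 1, ..., n, hence characteristic 0. *)
Lemma modXn_primitive n (p q : {poly k}) :
  p`_0 = 0 -> p^`() = q * 'X^n -> forall i, (i < n.+1)%N -> p`_i = 0.
Proof.
move=> p0 dp [|i] // lin; have := congr1 (fun p : {poly k} => p`_i) dp.
rewrite coef_deriv coefMXn -ltnS lin -mulr_natr => /eqP.
by rewrite mulf_eq0 (negPf (natf_neq0_char0 i)) orbF => /eqP.
Qed.

Lemma coef0_comp (p q : {poly k}) : q`_0 = 0 -> (p \Po q)`_0 = p`_0.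
Proof. by move=> q0; rewrite -!horner_coef0 horner_comp (horner_coef0 q) q0. Qed.

(** With Y = exp X - 1, both Y' = 1 + Y and (1 + Y) log'(1 + Y) = 1 hold up to multiples of X^n,
    because Y is divisible by X. So log(1 + Y) - X has derivative 0 modulo X^n. *)
Lemma log_poly_exp n i : (i < n.+1)%N ->
  (log_poly n.+1 \Po (exp_poly n.+1 - 1) - 'X)`_i = 0.
Proof.
set Y := exp_poly n.+1 - 1; set c := (n`!)%:R^-1 : k.
have Y0 : Y`_0 = 0 by rewrite coefB exp_poly0 coef1 subrr.
have [Z YZ] : exists Z, Y = Z * 'X.
  have /factor_theorem[Z ->] : root Y 0 by rewrite rootE horner_coef0 Y0.
  by exists Z; rewrite subr0.
have dY : Y^`() = 1 + Y - c *: 'X^n.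
  by rewrite derivB -{1}polyC1 derivC deriv_exp_poly (exp_polyS n) /Y /c; ring.
set L := (log_poly n.+1)^`().
have LY : (1 + Y) * (L \Po Y) = 1 - (- Y) ^+ n.
  have := congr1 (fun p => p \Po Y) (deriv_log_poly n).
  rewrite comp_polyM comp_polyD comp_polyB comp_polyX -polyC1 !comp_polyC => ->.
  by rewrite (rmorphXn (comp_poly Y)) /= rmorphN /= comp_polyX.
apply: (@modXn_primitive n _ (- (- Z) ^+ n - c *: (L \Po Y))).
  by rewrite coefB coef0_comp // coefX subr0 coef_poly.
rewrite derivB deriv_comp derivX dY -/L mulrBr mulrC LY YZ.
rewrite -!mul_polyC -[- (Z * _)]mulNr exprMn_comm; last exact: mulrC.
ring.
Qed.

(** The product exp(X) exp(-X) has constant term 1 and derivative 0, up to the error made by the top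
    terms that differentiation loses in the two truncations. *)
Lemma exp_polyN n i : (i < n.+1)%N ->
  (exp_poly n.+1 * (exp_poly n.+1 \Po - 'X) - 1)`_i = 0.
Proof.
set E := exp_poly n.+1; set c := (n`!)%:R^-1 : k.
have NX0 : (- 'X : {poly k})`_0 = 0 by rewrite coefN coefX oppr0.
have dE : E^`() = E - c *: 'X^n by rewrite deriv_exp_poly exp_polyS.
apply: (@modXn_primitive n _
    (- (c *: (E \Po - 'X)) + (c * (-1) ^+ n) *: E)).
  by rewrite coefB coef0M coef0_comp // !exp_poly0 coef1 mulr1 subrr.
rewrite derivB derivM deriv_comp derivN derivX -polyC1 derivC subr0 polyC1 dE.
rewrite comp_polyB comp_polyZ.
have -> : 'X^n \Po (- 'X) = (-1) ^+ n * 'X^n :> {poly k}.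
  by rewrite (rmorphXn (comp_poly (- 'X))) /= comp_polyX [LHS]exprNn.
rewrite -!mul_polyC polyCM rmorphXn /= rmorphN /= polyC1; ring.
Qed.

End TruncatedExpLog.

Section ExpLog.
Variables (k : fieldType) (char0 : [pchar k] =i pred0).
Variables (H : algType (hser k)) (freeH : topologically_free H).
Implicit Types (x y : H) (p q : {poly k}).

(** A ring morphism from polynomials over k, through which the formal identities between truncations
    of exp and log are carried to H. *)
Definition poly_eval x : {poly k} -> H :=
  horner_alg x \o map_poly (@hser_const k).

HB.instance Definition _ x := GRing.RMorphism.on (poly_eval x).

Lemma poly_evalZX x c i : poly_eval x (c *: 'X^i) = hser_const c *: x ^+ i.
Proof.
rewrite /poly_eval /= map_polyZ map_polyXn linearZ /= rmorphXn /= horner_algX.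
exact: mulr_algl.
Qed.

Lemma poly_evalX x : poly_eval x 'X = x.
Proof. by rewrite /poly_eval /= map_polyX horner_algX. Qed.

Lemma poly_evalC x c : poly_eval x c%:P = hser_const c *: 1.
Proof. by rewrite -[c%:P]mulr1 mul_polyC -(expr0 'X) poly_evalZX expr0. Qed.

Lemma poly_eval_comp x p q : poly_eval x (p \Po q) = poly_eval (poly_eval x q) p.
Proof.
elim/poly_ind: p => [|p c IH]; first by rewrite comp_poly0 !rmorph0.
rewrite comp_polyD comp_polyM comp_polyX comp_polyC !rmorphD !rmorphM /= IH.
by rewrite poly_evalX !poly_evalC.
Qed.

Lemma poly_eval_poly x n (a : nat -> k) :
  poly_eval x (\poly_(i < n) a i) = \sum_(i < n) hser_const (a i) *: x ^+ i.
Proof.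
by rewrite poly_def rmorph_sum; apply: eq_bigr => i _; exact: poly_evalZX.
Qed.

(** Since hbar divides x, precision in powers of X becomes precision in powers of hbar. *)
Lemma poly_eval_modXn x p n : in_hbar 1 x ->
  (forall i, (i < n)%N -> p`_i = 0) -> in_hbar n (poly_eval x p).
Proof.
move=> hx p0; rewrite -[p]coefK poly_eval_poly; apply: in_hbar_sum => i _.
case: (ltnP i n) => ni; first by rewrite p0 // raddf0 scale0r; exact: in_hbar0.
by apply: in_hbarZ; apply: in_hbarW ni _; exact: in_hbarX.
Qed.

Lemma poly_eval_congr n x y p : in_hbar n (x - y) ->
  in_hbar n (poly_eval x p - poly_eval y p).
Proof.
move=> hxy; rewrite -[p]coefK !poly_eval_poly -sumrB; apply: in_hbar_sum => i _.
by rewrite -scalerBr; apply: in_hbarZ; exact: in_hbar_subX.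
Qed.

Lemma poly_series_limit x (a : nat -> k) : in_hbar 1 x ->
  exists l, forall n, in_hbar n (poly_eval x (\poly_(i < n) a i) - l).
Proof.
move=> hx; have [|l hl] := @series_limit _ _ freeH
    (fun i => hser_const (a i) *: x ^+ i).
  by move=> n; apply: in_hbarZ; exact: in_hbarX.
by exists l => n; rewrite poly_eval_poly.
Qed.

Lemma hexp_approx x n : in_hbar 1 x ->
  in_hbar n (hexp x - poly_eval x (exp_poly k n)).
Proof.
move=> hx; have [l hl] := poly_series_limit (fun i => (i`!)%:R^-1) hx.
suff -> : hexp x = l by apply: in_hbarBC; exact: hl.
apply: hlimE => // N; exists N => m Nm; apply: in_hbarW Nm _.
by have := hl m; rewrite poly_eval_poly.
Qed.

Lemma hexp_unique x z : in_hbar 1 x ->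
  (forall n, in_hbar n.+1 (z - poly_eval x (exp_poly k n.+1))) -> z = hexp x.
Proof.
move=> hx hz; apply: (in_hbar_eq freeH) => n; apply: (in_hbarW (leqnSn n)).
apply: in_hbarB_trans (hz n) _; exact/in_hbarBC/hexp_approx.
Qed.

Lemma hexp_sub1 x : in_hbar 1 x -> in_hbar 1 (hexp x - 1).
Proof.
move=> hx; have := hexp_approx 1 hx.
by rewrite poly_eval_poly big_ord1 fact0 invr1 scale1r expr0.
Qed.

Lemma hlog_approx x n : in_hbar 1 (x - 1) ->
  in_hbar n (hlog x - poly_eval (x - 1) (log_poly k n)).
Proof.
move=> hx; pose a i : k := if i == 0%N then 0 else (-1) ^+ i.+1 / i%:R.
have [l hl] := poly_series_limit a hx.
suff -> : hlog x = l by apply: in_hbarBC; exact: hl.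
apply: hlimE => // N; exists N => m Nm; apply: in_hbarW Nm _.
suff -> : \sum_(1 <= i < m) hser_const ((-1) ^+ i.+1 / i%:R : k) *: (x - 1) ^+ i
   = poly_eval (x - 1) (\poly_(i < m) a i) by exact: hl.
rewrite poly_eval_poly -(big_mkord xpredT (fun i => hser_const (a i) *: _ ^+ i)).
(* The series of [hlog] starts at 1 and [log_poly] at 0, with a zero coefficient there. *)
case: m => [|m]; first by rewrite !big_geq.
rewrite [RHS]big_ltn // /a eqxx raddf0 scale0r add0r.
by apply: eq_big_nat => -[|i].
Qed.

Lemma hexpK x : in_hbar 1 x -> hlog (hexp x) = x.
Proof.
move=> hx; apply: (in_hbar_eq freeH) => n; apply: (in_hbarW (leqnSn n)).
apply: in_hbarB_trans (hlog_approx _ (hexp_sub1 hx)) _.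
(* Both series are replaced by truncations, so that their composition becomes a composition of
   polynomials. *)
have hE : in_hbar n.+1 (hexp x - 1 - poly_eval x (exp_poly k n.+1 - 1)).
  by rewrite rmorphB rmorph1 opprB addrA subrK; exact: hexp_approx.
apply: in_hbarB_trans (poly_eval_congr _ hE) _.
rewrite -poly_eval_comp -{2}[x]poly_evalX -rmorphB.
apply: poly_eval_modXn => // i; exact: log_poly_exp.
Qed.

Lemma hexpN x : in_hbar 1 x -> hexp x * hexp (- x) = 1.
Proof.
move=> hx; have hNx := in_hbarN hx.
apply: (in_hbar_eq freeH) => n; apply: (in_hbarW (leqnSn n)).
set e := poly_eval x (exp_poly k n.+1).
set f := poly_eval x (exp_poly k n.+1 \Po - 'X).
have hf : in_hbar n.+1 (hexp (- x) - f).
  by rewrite /f poly_eval_comp rmorphN /= poly_evalX; exact: hexp_approx.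
apply: (@in_hbarB_trans _ _ _ _ (e * f)).
  have -> : hexp x * hexp (- x) - e * f =
      (hexp x - e) * hexp (- x) + e * (hexp (- x) - f).
    by rewrite mulrBl mulrBr addrA subrK.
  by apply: in_hbarD; [apply/in_hbarMr/hexp_approx|exact: in_hbarMl].
rewrite -rmorphM -(rmorph1 (poly_eval x)) -rmorphB.
apply: poly_eval_modXn => // i; exact: exp_polyN.
Qed.

End ExpLog.

(** An algebra morphism commutes with the truncations and, being linear, preserves divisibility by
    hbar^n; hence it commutes with the limit. *)
Lemma hexp_morph (k : fieldType) (H H' : algType (hser k)) (f : H -> H') x :
  topologically_free H -> topologically_free H' ->
  linear f -> f 1 = 1 -> (forall y z, f (y * z) = f y * f z) ->
  in_hbar 1 x -> f (hexp x) = hexp (f x).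
Proof.
move=> freeH freeH' lf f1 fM hx; apply: hexp_unique => //.
  exact: in_hbar_linear.
move=> n; pose fL := GRing.isLinear.Build _ _ _ _ f lf.
pose g : {linear H -> H'} := HB.pack f fL.
have fX i : g (x ^+ i) = (g x) ^+ i.
  by elim: i => [|i IH]; rewrite ?expr0 // !exprS -IH -fM.
have -> : poly_eval (f x) (exp_poly k n.+1) = g (poly_eval x (exp_poly k n.+1)).
  rewrite !poly_eval_poly linear_sum; apply: eq_bigr => i _.
  by rewrite linearZ fX.
rewrite -[f _]/(g _) -linearB; apply: in_hbar_linear => //.
exact: hexp_approx.
Qed.

(** * Formal power series and the weak topology *)

Section PowerSeries.
Variables (k : fieldType) (d : nat).
Local Notation mexp := {ffun 'I_d -> nat}.
Implicit Types (f g : pseries k d) (a b : mexp) (i j : 'I_d).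

Definition mdeg a := (\sum_i a i)%N.
Definition mexp_unit i : mexp := [ffun j => nat_of_bool (j == i)].
Definition mexp_sub a b : mexp := [ffun i => (a i - b i)%N].
Definition pseries_var i : pseries k d := fun a => (a == mexp_unit i)%:R.

Lemma mexp_subK a b : (forall i, (b i <= a i)%N) ->
  mexp_sub a (mexp_sub a b) = b.
Proof. by move=> ba; apply/ffunP => i; rewrite !ffunE subKn. Qed.

Lemma mdeg_sub a b : (forall i, (b i <= a i)%N) ->
  (mdeg b + mdeg (mexp_sub a b))%N = mdeg a.
Proof.
move=> ba; rewrite /mdeg -big_split; apply: eq_bigr => i _.
by rewrite /= ffunE subnKC.
Qed.

Lemma mdeg_unit i : mdeg (mexp_unit i) = 1%N.
Proof.
rewrite /mdeg (bigD1 i) //= ffunE eqxx big1 ?addn0 // => j ji.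
by rewrite ffunE (negPf ji).
Qed.

Lemma mexp_unitP i a : reflect (forall j, (mexp_unit i j <= a j)%N) (0 < a i)%N.
Proof.
apply: (iffP idP) => [ai j|/(_ i)]; last by rewrite ffunE eqxx.
by rewrite ffunE; case: eqP => // ->.
Qed.

Lemma mdeg_eq0 a : (mdeg a == 0%N) = (a == [ffun=> 0%N]).
Proof.
rewrite /mdeg sum_nat_eq0; apply/forallP/eqP => [h|-> i]; last by rewrite ffunE.
by apply/ffunP => i; rewrite ffunE; exact/eqP/(h i).
Qed.

Lemma pseries_mulC f g : pseries_mul f g = pseries_mul g f.
Proof.
apply/funext => a; rewrite /pseries_mul.
set S := [set b : mexp | _].
rewrite (@reindex_fsbig _ _ _ _ _ (mexp_sub a) S S); last first.
  split=> [b _ i|b c|b Sb]; first by rewrite ffunE leq_subr.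
    rewrite !inE /S /= => Sb Sc e.
    by rewrite -(mexp_subK Sb) e mexp_subK.
  exists (mexp_sub a b); last exact: mexp_subK.
  by move=> i; rewrite ffunE leq_subr.
apply: eq_fsbigr => b; rewrite inE => Sb.
by rewrite -[finfun _]/(mexp_sub a (mexp_sub a b)) mexp_subK // mulrC.
Qed.

Definition ord_ge n f := forall a, (mdeg a < n)%N -> f a = 0.

Lemma ord_ge_mul m n f g :
  ord_ge m f -> ord_ge n g -> ord_ge (m + n) (pseries_mul f g).
Proof.
move=> fm gn a; rewrite /pseries_mul => an; apply: fsbig1 => b /= Sb.
have := mdeg_sub Sb; case: (ltnP (mdeg b) m) => bm ab; first by rewrite fm ?mul0r.
rewrite gn ?mulr0 // -[finfun _]/(mexp_sub a b); lia.
Qed.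

Lemma pseries_varM i g a : pseries_mul (pseries_var i) g a =
  if (0 < a i)%N then g (mexp_sub a (mexp_unit i)) else 0.
Proof.
rewrite /pseries_mul /pseries_var; case: mexp_unitP => ai; last first.
  apply: fsbig1 => b /= Sb; case: eqP => [e|_]; last by rewrite mul0r.
  by case: ai => j; rewrite -e.
rewrite -(@fsbig_widen _ _ _ _ [set mexp_unit i]) ?fsbig_set1 ?eqxx ?mul1r //.
  by move=> b ->.
move=> b [_ /eqP/negPf]; rewrite /= => ->; exact: mul0r.
Qed.

(* The monomial x^a is assigned to the first variable it is divisible by. *)
Lemma ord_ge_decomp n f : ord_ge n.+1 f -> exists g : 'I_d -> pseries k d,
  (forall i, ord_ge n (g i)) /\
  f = \sum_i pseries_mul (pseries_var i) (g i).
Proof.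
move=> fn; pose g i : pseries k d := fun a =>
  if [forall j : 'I_d, (j < i)%N ==> (a j == 0%N)]
  then f [ffun j => (a j + (j == i))%N] else 0.
have deg_succ i a : mdeg [ffun j => (a j + (j == i))%N] = (mdeg a).+1.
  rewrite -addn1 -(mdeg_unit i) /mdeg -big_split; apply: eq_bigr => j _.
  by rewrite !ffunE.
exists g; split=> [i a an|]; first by rewrite /g fn ?if_same // deg_succ.
apply/funext => a; rewrite fct_sumE; case: (eqVneq (mdeg a) 0%N) => [a0|].
  rewrite fn ?a0 // big1 // => i _; rewrite pseries_varM.
  by move/eqP: a0; rewrite mdeg_eq0 => /eqP ->; rewrite ffunE.
rewrite /mdeg sum_nat_eq0 negb_forall => /existsP[i0 /= ai0].
case: (@arg_minnP _ i0 (fun i => a i != 0%N) (@nat_of_ord d) ai0) => i ai imin.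
rewrite (bigD1 i) //= big1 ?addr0 => [|j ji]; rewrite pseries_varM /g.
  rewrite lt0n ai ifT; last first.
    apply/forallP => j; apply/implyP => ji; rewrite ffunE.
    case: (eqVneq (a j) 0%N) => [->//|/imin]; by rewrite leqNgt ji.
  congr (f _); apply/ffunP => j; rewrite !ffunE.
  by case: (eqVneq j i) => [->|_]; rewrite ?subn0 ?addn0 // subnK // lt0n.
case: posnP => // aj; rewrite ifF //; apply/negbTE; rewrite negb_forall.
apply/existsP; exists i; rewrite negb_imply !ffunE.
have ji' : (i < j)%N.
  by rewrite ltn_neqAle imin -?lt0n // andbT eq_sym.
by rewrite ji' (negPf (_ : i != j)) ?subn0 // eq_sym.
Qed.

(** Makes having order at least n an open condition in the weak topology. *)
Lemma finite_mdeg n : finite_set [set a : mexp | (mdeg a < n)%N].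
Proof.
apply: (@sub_finite_set _ _
  [set [ffun i => nat_of_ord (b i)] | b in [set: {ffun 'I_d -> 'I_n.+1}]]).
  move=> a /= an; exists [ffun i => inord (a i)] => //.
  apply/ffunP => i; rewrite !ffunE inordK // ltnS.
  by apply: leq_trans (ltnW an); rewrite /mdeg (bigD1 i) //= leq_addr.
by apply: finite_image; exact: finite_finset.
Qed.

End PowerSeries.

Section Weak.
Variable k : fieldType.

Lemma hser_in_hbarP N (a : (hser k)^o) :
  in_hbar N a <-> forall n, (n < N)%N -> a n = 0.
Proof.
split=> [[b ->] n nN|a0].
  by rewrite [hbar ^+ N *: b](_ : _ = hbar ^+ N * (b : hser k)) // hbarXM nN.
exists (fun n => a (n + N)%N); apply/funext => n.
rewrite [RHS](_ : _ = (hbar ^+ N * (fun n => a (n + N)%N)) n) // hbarXM.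
by case: ltnP => nN; [exact: a0|rewrite subnK].
Qed.

(** For finite A, these are the basic weak neighbourhoods of 0. *)
Definition small (E : Type) (A : set E) (N : nat) (u : wprod k E) :=
  forall e, A e -> in_hbar N (u e).

Section Small.
Variable E : Type.
Implicit Types (A B : set E) (u v : wprod k E).

Lemma small0 A N : small A N 0.
Proof. by move=> e _; exact: in_hbar0. Qed.

Lemma smallD A N u v : small A N u -> small A N v -> small A N (u + v).
Proof. by move=> hu hv e Ae; apply: in_hbarD; [exact: hu|exact: hv]. Qed.

Lemma smallW A B N M u : (M <= N)%N -> B `<=` A -> small A N u -> small B M u.
Proof. by move=> MN BA hu e /BA /hu; exact: in_hbarW. Qed.

Lemma wprod_in_hbarP N u : in_hbar N u <-> forall e, in_hbar N (u e).
Proof.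
split=> [[v ->] e|]; first by exists (v e).
by move=> /choice[v hv]; exists v; apply/funext.
Qed.

Lemma wprod_free : topologically_free (wprod k E).
Proof.
exists (kprod k E : lmodType k), (fun x n e => x e n); split.
- by exists (fun y e n => y n e).
- by [].
- move=> a x n; apply/funext => e; rewrite fct_sumE.
  by rewrite [LHS](_ : _ = \sum_(i < n.+1) a i * (x e (n - i)%N)).
Qed.

Lemma modh_eq0 u : modh u = 0 <-> in_hbar 1 u.
Proof.
split=> [u0|/wprod_in_hbarP u0].
  apply/wprod_in_hbarP => e; apply/hser_in_hbarP => -[] // _.
  exact: (congr1 (fun f => f e) u0).
by apply/funext => e; exact: ((hser_in_hbarP 1 (u e)).1 (u0 e)).
Qed.

Lemma modhD u v : modh (u + v) = modh u + modh v. Proof. by []. Qed.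
Lemma modhN u : modh (- u) = - modh u. Proof. by []. Qed.
Lemma modhB u v : modh (u - v) = modh u - modh v. Proof. by []. Qed.

Lemma modhZ (a : hser k) u : modh (a *: u) = a 0%N *: modh u.
Proof. by apply/funext => e; exact: hserM0. Qed.

Lemma modh_sum (I : Type) (s : seq I) (u : I -> wprod k E) :
  modh (\sum_(i <- s) u i) = \sum_(i <- s) modh (u i).
Proof. by elim: s => [|i s IH]; rewrite ?big_nil // !big_cons modhD IH. Qed.

Lemma lifthK (x : kprod k E) : modh (lifth x) = x.
Proof. by []. Qed.

Lemma modh_eqP u v : modh u = modh v -> exists w, u = v + hbar *: w.
Proof.
move=> e; have /modh_eq0[w hw] : modh (u - v) = 0 by rewrite modhB e subrr.
by exists w; rewrite -[_ *: w]/(hbar ^+ 1 *: w) -hw addrC subrK.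
Qed.

Lemma modh_small A u : small A 1 u <-> forall e, A e -> modh u e = 0.
Proof.
split=> [hu e /hu /hser_in_hbarP h|hu e Ae]; first exact: h.
by apply/hser_in_hbarP => -[] // _; exact: hu.
Qed.

Lemma small_decomp A N u : small A N u -> exists v w,
  u = v + hbar ^+ N *: w /\ forall e, A e -> v e = 0.
Proof.
move=> hu; have [|w hw] := @choice _ _
    (fun e y => u e = (if `[< A e >] then 0 else u e) + hbar ^+ N *: y).
  move=> e; case: asboolP => [/hu[y ->]|_]; last by exists 0; rewrite scaler0 addr0.
  by exists y; rewrite add0r.
exists (fun e => if `[< A e >] then 0 else u e), w; split; first exact/funext.
by move=> e Ae; rewrite asboolT.
Qed.

Lemma weak_contP (M : Type) (nM : set (set M)) (f : wprod k E -> M) W :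
  continuous0 (@weak_nbhs0 k E) nM f -> nM W ->
  exists A N, finite_set A /\ forall u, small A N u -> W (f u).
Proof. by move=> fc /fc [A [N [fA AN]]]; exists A, N; split. Qed.

End Small.

Section Tensors.
Variables X Y : Type.
Implicit Types (x y : wprod k X) (z t : wprod k Y).

Lemma wtensDl x y z : wtens (x + y) z = wtens x z + wtens y z.
Proof. by apply/funext => p; exact: mulrDl. Qed.
Lemma wtensDr x z t : wtens x (z + t) = wtens x z + wtens x t.
Proof. by apply/funext => p; exact: mulrDr. Qed.
Lemma wtensZl (a : hser k) x z : wtens (a *: x) z = a *: wtens x z.
Proof. by apply/funext => p; exact/esym/mulrA. Qed.
Lemma wtensZr (a : hser k) x z : wtens x (a *: z) = a *: wtens x z.
Proof. by apply/funext => p; exact: mulrCA. Qed.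

Lemma modh_wtens x z : modh (wtens x z) = wtens (modh x) (modh z).
Proof. by apply/funext => p; exact: hserM0. Qed.

End Tensors.

End Weak.

(* an alias, as functions to a ring also carry the pointwise product *)
Definition wring (k : fieldType) (F : wHopf k) : Type := wF k F.
HB.instance Definition _ (k : fieldType) (F : wHopf k) :=
  GRing.Lmodule.copy (wring F) (wF k F).

(** * F as a ring, and coordinates on its reduction modulo hbar *)

Section Ring.
Variables (k : fieldType) (F : wHopf k).
Implicit Types x y z : wring F.

Definition wring_mul x y : wring F := wmul F (wtens x y).

Lemma wring_mulA : associative wring_mul. Proof. exact: wmulA. Qed.
Lemma wring_mul1 : left_id (wone F : wring F) wring_mul.
Proof. exact: wmul1l. Qed.
Lemma wring_1mul : right_id (wone F : wring F) wring_mul.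
Proof. exact: wmul1r. Qed.
Lemma wring_mulDl : left_distributive wring_mul +%R.
Proof. by move=> x y z; rewrite /wring_mul wtensDl linearD. Qed.
Lemma wring_mulDr : right_distributive wring_mul +%R.
Proof. by move=> x y z; rewrite /wring_mul wtensDr linearD. Qed.
Lemma wring_1neq0 : (wone F : wring F) != 0.
Proof.
apply/eqP => e; have := wcou1 F; rewrite [wone F]e linear0.
by move/esym/eqP; rewrite oner_eq0.
Qed.

HB.instance Definition _ := GRing.Zmodule_isNzRing.Build (wring F)
  wring_mulA wring_mul1 wring_1mul wring_mulDl wring_mulDr wring_1neq0.

Lemma wring_scalerAl (a : hser k) x y : a *: (x * y) = (a *: x) * y.
Proof. by rewrite -[RHS]/(wmul F _) wtensZl linearZZ. Qed.
Lemma wring_scalerAr (a : hser k) x y : a *: (x * y) = x * (a *: y).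
Proof. by rewrite -[RHS]/(wmul F _) wtensZr linearZZ. Qed.

HB.instance Definition _ :=
  GRing.Lmodule_isLalgebra.Build (hser k) (wring F) wring_scalerAl.
HB.instance Definition _ :=
  GRing.Lalgebra_isAlgebra.Build (hser k) (wring F) wring_scalerAr.

Definition eps x : hser k := wcou F x.

Lemma epsD x y : eps (x + y) = eps x + eps y. Proof. exact: linearD. Qed.
Lemma epsZ a x : eps (a *: x) = a * eps x. Proof. exact: (linearZZ (wcou F) a x). Qed.
Lemma epsB x y : eps (x - y) = eps x - eps y. Proof. exact: linearB. Qed.
Lemma epsM x y : eps (x * y) = eps x * eps y. Proof. exact: wcouM. Qed.
Lemma eps0 : eps 0 = 0. Proof. exact: linear0. Qed.
Lemma eps1 : eps 1 = 1. Proof. exact: wcou1. Qed.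

(** [mul0] multiplies constant lifts, which differ from x and y by multiples of hbar. *)
Lemma modhM x y : modh (x * y) = mul0 F (modh x) (modh y).
Proof.
have [u xu] := modh_eqP (lifthK (modh x)).
have [v yv] := modh_eqP (lifthK (modh y)).
have xu' : (lifth (modh x) : wring F) = x + hbar *: (u : wring F) by [].
have yv' : (lifth (modh y) : wring F) = y + hbar *: (v : wring F) by [].
rewrite -[RHS]/(modh ((lifth (modh x) : wring F) * (lifth (modh y) : wring F))).
rewrite xu' yv' mulrDl mulrDr -scalerAl -scalerAr -addrA -scalerDr.
by rewrite [RHS]modhD [X in _ + X]modhZ scale0r addr0.
Qed.

End Ring.

(** The data hidden in [is_QFSHA], with an explicit inverse, so that coordinates can be fixed once
    and for all. *)
Record chart (k : fieldType) (F : wHopf k) := Chart {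
  chart_dim : nat;
  chart_map : {linear pseries k chart_dim -> kprod k (wE F)};
  chart_inv : kprod k (wE F) -> pseries k chart_dim;
  chart_mapK : cancel chart_map chart_inv;
  chart_invK : cancel chart_inv chart_map;
  chart_nbhs : forall W,
    kweak_nbhs0 W <-> kweak_nbhs0 (chart_map @^-1` W);
  chart_one : chart_map (@pseries_one k chart_dim) = one0 F;
  chart_mul : forall f g,
    chart_map (pseries_mul f g) = mul0 F (chart_map f) (chart_map g) }.

Arguments chart_dim {k F} c.
Arguments chart_map {k F} c.
Arguments chart_inv {k F} c.
Arguments chart_nbhs {k F} c.
Arguments chart_one {k F} c.

Lemma QFSHA_chart (k : fieldType) (F : wHopf k) : is_QFSHA F -> inhabited (chart F).
Proof. by case=> d [th [[g gK Kg] thn th1 thM]]; split; exact: (Chart gK Kg). Qed.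

Section Coefficients.
Variables (k : fieldType) (F : wHopf k) (C : chart F).
Local Notation d := (chart_dim C).
Local Notation mexp := {ffun 'I_d -> nat}.
Implicit Types (a b : mexp) (x y z : wring F) (i j : 'I_d).

Definition tcoef a (x : kprod k (wE F)) : k := chart_inv C x a.

Lemma tcoef_linear a (c : k) u v : tcoef a (c *: u + v) = c * tcoef a u + tcoef a v.
Proof.
have e : chart_inv C (c *: u + v) = c *: chart_inv C u + chart_inv C v.
  by rewrite -[RHS]chart_mapK linearP /= !chart_invK.
by rewrite /tcoef e.
Qed.

Lemma tcoefD a u v : tcoef a (u + v) = tcoef a u + tcoef a v.
Proof. by have := tcoef_linear a 1 u v; rewrite scale1r mul1r. Qed.
Lemma tcoef0 a : tcoef a 0 = 0.
Proof. by apply: (addrI (tcoef a 0)); rewrite -tcoefD !addr0. Qed.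
Lemma tcoefZ a c u : tcoef a (c *: u) = c * tcoef a u.
Proof. by rewrite -[c *: u]addr0 tcoef_linear tcoef0 addr0. Qed.
Lemma tcoefB a u v : tcoef a (u - v) = tcoef a u - tcoef a v.
Proof. by rewrite tcoefD -scaleN1r tcoefZ mulN1r. Qed.
Lemma tcoef_sum a (I : Type) (s : seq I) (P : pred I) u :
  tcoef a (\sum_(i <- s | P i) u i) = \sum_(i <- s | P i) tcoef a (u i).
Proof. by apply: (big_morph (tcoef a)); [exact: tcoefD|exact: tcoef0]. Qed.

Lemma tcoef_inj u v : (forall a, tcoef a u = tcoef a v) -> u = v.
Proof. by move=> e; apply: (can_inj (chart_invK C)); exact/funext. Qed.

Lemma tcoef_map f a : tcoef a (chart_map C f) = f a.
Proof. by rewrite /tcoef chart_mapK. Qed.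

Lemma tcoef_mul0 u v a :
  tcoef a (mul0 F u v) = pseries_mul (chart_inv C u) (chart_inv C v) a.
Proof.
by rewrite /tcoef -{1}(chart_invK C u) -{1}(chart_invK C v) -chart_mul chart_mapK.
Qed.

Lemma tcoef_one a : tcoef a (one0 F) = if a == [ffun => 0%N] then 1 else 0.
Proof. by rewrite -(chart_one C) tcoef_map. Qed.

Lemma mul0C u v : mul0 F u v = mul0 F v u.
Proof. by apply: tcoef_inj => a; rewrite !tcoef_mul0 pseries_mulC. Qed.

(* the classes of order at least n form the n-th power of the maximal ideal *)
Definition order_ge n (u : kprod k (wE F)) :=
  forall a, (mdeg a < n)%N -> tcoef a u = 0.

Lemma order_ge_ord n u : order_ge n u <-> ord_ge n (chart_inv C u).
Proof. by []. Qed.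

Lemma order_geD n u v : order_ge n u -> order_ge n v -> order_ge n (u + v).
Proof. by move=> hu hv a an; rewrite tcoefD hu // hv // addr0. Qed.
Lemma order_ge0 n : order_ge n 0. Proof. by move=> a _; exact: tcoef0. Qed.
Lemma order_geZ n c u : order_ge n u -> order_ge n (c *: u).
Proof. by move=> hu a an; rewrite tcoefZ hu // mulr0. Qed.
Lemma order_geN n u : order_ge n u -> order_ge n (- u).
Proof. by rewrite -scaleN1r; exact: order_geZ. Qed.
Lemma order_geW n m u : (m <= n)%N -> order_ge n u -> order_ge m u.
Proof. by move=> mn hu a am; apply: hu; exact: leq_trans mn. Qed.
Lemma order_geM m n u v :
  order_ge m u -> order_ge n v -> order_ge (m + n) (mul0 F u v).
Proof. by move=> hu hv a an; rewrite tcoef_mul0; exact: (ord_ge_mul hu hv). Qed.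

Lemma tcoef_continuous a : exists A : set (wE F), finite_set A /\
  forall u, (forall e, A e -> u e = 0) -> tcoef a u = 0.
Proof.
have /(chart_nbhs C)[A [fA AW]] :
    kweak_nbhs0 (chart_map C @^-1` [set u | tcoef a u = 0]).
  exists [set a]; split; first exact: finite_set1.
  by move=> f /(_ a erefl); rewrite /= tcoef_map.
by exists A; split=> // u hu; exact: AW.
Qed.

(** Together with [order_ge_small]: the chart being a homeomorphism, the product topology on F /
    hbar F is the adic topology of the maximal ideal. *)
Lemma order_ge_nbhs n : exists A : set (wE F), finite_set A /\
  forall u, (forall e, A e -> u e = 0) -> order_ge n u.
Proof.
have /(chart_nbhs C)[A [fA AW]] :
    kweak_nbhs0 (chart_map C @^-1` [set u | order_ge n u]).
  exists [set a : mexp | (mdeg a < n)%N]; split; first exact: finite_mdeg.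
  by move=> f fn a an; rewrite tcoef_map; exact: fn.
by exists A; split=> // u hu; exact: AW.
Qed.

Lemma order_ge_small (A : set (wE F)) : finite_set A ->
  exists n, forall u, order_ge n u -> forall e, A e -> u e = 0.
Proof.
move=> fA; have /(chart_nbhs C)[B [fB BW]] :
    kweak_nbhs0 [set u : kprod k (wE F) | forall e, A e -> u e = 0].
  by exists A; split.
have [s Bs] := (finite_seqP B).1 fB.
exists (\max_(a <- s) mdeg a).+1 => u hu e Ae.
rewrite -(chart_invK C u); apply: (BW (chart_inv C u)) => // a.
rewrite Bs /= => sa; apply: hu; rewrite ltnS.
exact: (@leq_bigmax_seq _ _ xpredT (@mdeg d)).
Qed.

Lemma small_order n : exists A : set (wE F), finite_set A /\
  forall x, small A 1 x -> order_ge n (modh x).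
Proof.
have [A [fA hA]] := order_ge_nbhs n.
by exists A; split=> // x /modh_small hx; exact: hA.
Qed.

Lemma order_small (A : set (wE F)) : finite_set A ->
  exists n, forall x, order_ge n (modh x) -> small A 1 x.
Proof.
move=> fA; have [n hn] := order_ge_small fA.
by exists n => x hx; apply/modh_small; exact: hn.
Qed.

Lemma order_geX n x : order_ge 1 (modh x) -> order_ge n (modh (x ^+ n)).
Proof.
move=> hx; elim: n => [|n IH]; first by move=> a.
by rewrite exprS modhM -add1n; exact: order_geM.
Qed.

Lemma tcoef00 u : order_ge 1 u <-> tcoef [ffun => 0%N] u = 0.
Proof.
split=> [hu|hu a]; first by apply: hu; rewrite ltnS leqn0 mdeg_eq0.
by rewrite ltnS leqn0 mdeg_eq0 => /eqP ->.
Qed.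

(* eps mod hbar is a continuous character, and the powers of a series without *)
(* constant term tend to 0 *)
Lemma eps_modh x : (eps x) 0%N = tcoef [ffun => 0%N] (modh x).
Proof.
suff eps0 y : order_ge 1 (modh y) -> eps y 0%N = 0.
  pose c := tcoef [ffun => 0%N] (modh x).
  have : eps (x - hser_const c *: 1) 0%N = 0.
    apply/eps0/tcoef00; rewrite modhB modhZ tcoefB tcoefZ.
    by rewrite -[modh (1 : wring F)]/(one0 F) tcoef_one eqxx mulr1 subrr.
  rewrite epsB epsZ eps1 mulr1 hserD hserN /hser_const /= => /eqP.
  by rewrite subr_eq0 => /eqP.
move=> hy; have nbhs1 : hbar_nbhs0 (in_hbar (M := (hser k)^o) 1) by exists 1%N.
have [A [N [fA hA]]] := weak_contP (@wcou_cont k F) nbhs1.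
have [n hn] := order_small fA.
have hyn := hn _ (order_geX hy).
have [v [w [yvw v0]]] := small_decomp hyn.
(* By multiplicativity this is the n-th power of the constant term of eps y, and a field has no
   nilpotents. *)
have : (eps (y ^+ n)) 0%N = 0.
  rewrite [y ^+ n]yvw [eps _](epsD (v : wring F) (hbar ^+ 1 *: (w : wring F))).
  rewrite epsZ hserD hserM0 hbarX mul0r addr0.
  apply: (hser_in_hbarP 1 _).1 => //; apply: hA => e Ae.
  by rewrite v0 //; exact: in_hbar0.
have -> : (eps (y ^+ n)) 0%N = (eps y 0%N) ^+ n.
  elim: n {hn hyn yvw} => [|n IH]; first by rewrite expr0 eps1.
  by rewrite !exprS epsM hserM0 IH.
by move/eqP; rewrite expf_eq0 => /andP[_ /eqP].
Qed.

Lemma max_idealE u : max_ideal F u <-> order_ge 1 u.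
Proof.
by rewrite tcoef00 -[X in tcoef _ X](lifthK u) -(eps_modh (lifth u : wring F)).
Qed.

Definition var0 i : kprod k (wE F) := chart_map C (pseries_var k i).

Lemma tcoef_var0 i a : tcoef a (var0 i) = (a == mexp_unit i)%:R.
Proof. by rewrite tcoef_map. Qed.

Lemma var0_order i : order_ge 1 (var0 i).
Proof.
move=> a; rewrite tcoef_var0; case: eqP => // ->.
by rewrite mdeg_unit.
Qed.

Lemma tcoef_varM i u a : tcoef a (mul0 F (var0 i) u) =
  if (0 < a i)%N then tcoef (mexp_sub a (mexp_unit i)) u else 0.
Proof. by rewrite tcoef_mul0 chart_mapK pseries_varM. Qed.

Lemma order_ge_decomp n u : order_ge n.+1 u ->
  exists v : 'I_d -> kprod k (wE F), (forall i, order_ge n (v i)) /\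
  u = \sum_i mul0 F (var0 i) (v i).
Proof.
move=> /order_ge_ord /ord_ge_decomp[g [gn ug]].
exists (fun i => chart_map C (g i)); split=> [i a an|].
  by rewrite tcoef_map; exact: gn.
rewrite -{1}(chart_invK C u) ug linear_sum; apply: eq_bigr => i _.
exact: chart_mul.
Qed.

(** With finitely many variables, a series of order 2 is a finite sum of products x_i v_i with v_i
    of order 1; the algebraic square of the maximal ideal is thus already closed. *)
Lemma max_ideal2E u : max_ideal2 F u <-> order_ge 2 u.
Proof.
split=> [[s [hs ->]]|].
  rewrite big_seq; elim/big_ind: _ => //.
  - exact: order_ge0.
  - exact: order_geD.
  - by move=> p /hs[/max_idealE h1 /max_idealE h2]; exact: (@order_geM 1 1).
move=> /order_ge_decomp[v [hv uv]].
exists [seq (var0 i, v i) | i <- enum 'I_d]; split.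
  by move=> p /mapP[i _ ->]; split; apply/max_idealE; [exact: var0_order|exact: hv].
by rewrite big_map big_enum.
Qed.

Definition lin i (u : kprod k (wE F)) := tcoef (mexp_unit i) u.

Lemma lin_var0 i j : lin i (var0 j) = (i == j)%:R.
Proof.
rewrite /lin tcoef_var0; congr (nat_of_bool _)%:R; apply/eqP/eqP => [|-> //].
by move/(congr1 (fun f : mexp => f i)); rewrite !ffunE eqxx; case: eqP.
Qed.

Lemma lin_order2 i u : order_ge 2 u -> lin i u = 0.
Proof. by move=> hu; apply: hu; rewrite mdeg_unit. Qed.

Lemma order_ge1_lin u : order_ge 1 u ->
  order_ge 2 (u - \sum_i lin i u *: var0 i).
Proof.
move=> hu a a2; rewrite tcoefB tcoef_sum.
have -> : \sum_i tcoef a (lin i u *: var0 i) =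
    \sum_i (a == mexp_unit i)%:R * lin i u.
  by apply: eq_bigr => i _; rewrite tcoefZ tcoef_var0 mulrC.
(* Below degree 2 the only exponents are 0 and those of the variables. *)
have [a0|/existsP[i ai]] : mdeg a = 0%N \/ [exists i, a == mexp_unit i].
- case a1 : (mdeg a) a2 => [|[|//]] _; [by left|right].
  have /existsP[i ai] : [exists i, a i != 0%N].
    move: a1; rewrite /mdeg; case: existsP => // h.
    by rewrite big1 // => i _; apply/eqP; case: eqP => // /eqP ai; case: h; exists i.
  apply/existsP; exists i; apply/eqP/ffunP => j; rewrite ffunE.
  move: a1; rewrite /mdeg (bigD1 i) //=; case: eqVneq => [->|ji]; first by lia.
  by rewrite (bigD1 j) //=; lia.
- rewrite hu ?a0 // big1 ?subrr // => i _.
  by case: eqP => [ai|_]; [move: a0; rewrite ai mdeg_unit|rewrite mul0r].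
- rewrite (eqP ai) (bigD1 i) //= eqxx mul1r big1 ?addr0 ?subrr // => j ji.
  have := lin_var0 i j; rewrite /lin tcoef_var0 => ->.
  by rewrite eq_sym (negPf ji) mul0r.
Qed.

End Coefficients.

Arguments tcoef {k F} C a x.
Arguments lin {k F} C i u.
Arguments var0 {k F} C i.

(** * The powers of the augmentation ideals *)

Section Filtrations.
Variables (k : fieldType) (F : wHopf k) (C : chart F).
Local Notation d := (chart_dim C).
Local Notation mexp := {ffun 'I_d -> nat}.
Implicit Types (a b : mexp) (x y z : wring F) (i j : 'I_d).

(* [jpow n] is J^n for J = Ker eps, with J^0 = F, and [ipow n] is             *)
(* I^n = \sum_i hbar^i J^(n - i) for I = hbar F + J                           *)
Inductive jpow : nat -> wring F -> Prop :=
| jpow_all x : jpow 0 x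
| jpow0 n : jpow n 0
| jpowD n x y of jpow n x & jpow n y : jpow n (x + y)
| jpowM n x y of eps x = 0 & jpow n y : jpow n.+1 (x * y).

Inductive ipow : nat -> wring F -> Prop :=
| ipow_jpow n x of jpow n x : ipow n x
| ipowD n x y of ipow n x & ipow n y : ipow n (x + y)
| ipow_hbar n x of ipow n x : ipow n.+1 (hbar *: x).

Lemma jpow_mull n x y : jpow n y -> jpow n (x * y).
Proof.
move=> hy; elim: hy x => {n y} [y|n|n y z _ IHy _ IHz|n y z ey hz _] x.
- exact: jpow_all.
- by rewrite mulr0; exact: jpow0.
- by rewrite mulrDr; exact: jpowD.
- by rewrite mulrA; apply: jpowM; rewrite // epsM ey mulr0.
Qed.

Lemma jpowZ n (c : hser k) x : jpow n x -> jpow n (c *: x).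
Proof. by rewrite -mulr_algl; exact: jpow_mull. Qed.

Lemma jpow1 x : eps x = 0 -> jpow 1 x.
Proof. by move=> ex; rewrite -[x]mulr1; apply: jpowM => //; exact: jpow_all. Qed.

Lemma jpow_mul m n x y : jpow m x -> jpow n y -> jpow (m + n) (x * y).
Proof.
move=> hx hy; elim: hx => {m x} [x|m|m x z _ IHx _ IHz|m x z ex _ IH].
- exact: jpow_mull.
- by rewrite mul0r; exact: jpow0.
- by rewrite mulrDl; exact: jpowD.
- by rewrite -mulrA; exact: jpowM.
Qed.

Lemma jpow_sum n (T : Type) (s : seq T) (x : T -> wring F) :
  (forall t, jpow n (x t)) -> jpow n (\sum_(t <- s) x t).
Proof. by move=> h; elim/big_ind: _ => //; [exact: jpow0|exact: jpowD]. Qed.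

Lemma jpow_pred n x : jpow n x -> jpow n.-1 x.
Proof.
elim=> {n x} [x|n|n x y _ IHx _ IHy|n x y _ hy _].
- exact: jpow_all.
- exact: jpow0.
- exact: jpowD.
- exact: jpow_mull.
Qed.

Lemma jpowW n m x : (m <= n)%N -> jpow n x -> jpow m x.
Proof.
move=> /subnKC <-; elim: (n - m)%N x => [|l IH] x; first by rewrite addn0.
by rewrite addnS => /jpow_pred /IH.
Qed.

(** J^(m+n) = J^m J^n, as an induction principle: an additive property need only be checked on
    products. *)
Lemma jpow_split N z : jpow N z -> forall m n (P : wring F -> Prop),
  N = (m + n)%N -> P 0 -> (forall x y, P x -> P y -> P (x + y)) ->
  (forall x y, jpow m x -> jpow n y -> P (x * y)) -> P z.
Proof.
elim=> {N z} [z|N|N x y _ IHx _ IHy|N x y ex hy IH] m n P Nmn P0 PD PM //.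
- case: m n PM Nmn => [|m] [|n] PM; rewrite ?addnS // => _.
  by rewrite -[z]mul1r; apply: PM; exact: jpow_all.
- by apply: (PD); [exact: (IHx m n P)|exact: (IHy m n P)].
- case: m Nmn PM => [|m] Nmn PM.
    rewrite -[x * y]mul1r; apply: PM; first exact: jpow_all.
    by rewrite -[n]add0n -Nmn; exact: jpowM.
  (* The left factor x is absorbed into the predicate. *)
  apply: (IH m n (fun y => P (x * y))); first by lia.
  + by rewrite mulr0.
  + by move=> y1 y2 h1 h2; rewrite mulrDr; exact: PD.
  + by move=> x1 y1 h1 h2; rewrite mulrA; apply: PM => //; exact: jpowM.
Qed.

Lemma eps_order x : eps x = 0 -> order_ge C 1 (modh x).
Proof. by move=> ex; apply/tcoef00; rewrite -eps_modh ex. Qed.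

Lemma jpow_order n x : jpow n x -> order_ge C n (modh x).
Proof.
elim=> {n x} [x|n|n x y _ IHx _ IHy|n x y ex _ IH].
- by move=> a.
- exact: order_ge0.
- exact: order_geD.
- by rewrite modhM -add1n; apply: order_geM => //; exact: eps_order.
Qed.

Lemma ipow_pred n x : ipow n x -> ipow n.-1 x.
Proof.
elim=> {n x} [n x hx|n x y _ IHx _ IHy|n x hx IH].
- by apply: ipow_jpow; exact: jpow_pred.
- exact: ipowD.
- case: n hx IH => [|n] hx IH; first by apply: ipow_jpow; exact: jpow_all.
  exact: ipow_hbar.
Qed.

Lemma ipow_all x : ipow 0 x.
Proof. by apply: ipow_jpow; exact: jpow_all. Qed.

Lemma ipow_mull n x y : ipow n y -> ipow n (x * y).
Proof.
move=> hy; elim: hy => {n y} [n y hy|n y z _ IHy _ IHz|n y _ IH].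
- by apply: ipow_jpow; exact: jpow_mull.
- by rewrite mulrDr; exact: ipowD.
- by rewrite -scalerAr; exact: ipow_hbar.
Qed.

Lemma ipowM n x y : eps x = 0 -> ipow n y -> ipow n.+1 (x * y).
Proof.
move=> ex; elim=> {n y} [n y hy|n y z _ IHy _ IHz|n y _ IH].
- by apply: ipow_jpow; exact: jpowM.
- by rewrite mulrDr; exact: ipowD.
- by rewrite -scalerAr; exact: ipow_hbar.
Qed.

Lemma ipow_hbarX m n x : ipow n x -> ipow (m + n) (hbar ^+ m *: x).
Proof.
move=> hx; elim: m => [|m IH]; first by rewrite expr0 scale1r.
by rewrite exprS -scalerA; exact: ipow_hbar.
Qed.

(** In a product of factors hbar y + z with z in J, the central hbar moves out. *)
Lemma aug_ideal_pow_ipow n x : aug_ideal_pow n x -> ipow n x.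
Proof.
elim: n x => [|n IH] x; first by move=> _; exact: ipow_all.
move=> [s [hs ->]]; rewrite big_seq.
elim/big_ind: _ => [|y z|p /hs[[y [z [ez ->]]] /IH hp]].
- by apply: ipow_jpow; exact: jpow0.
- exact: ipowD.
- rewrite -[wmul F _]/((hbar *: (y : wring F) + (z : wring F)) * _) mulrDl.
  apply: ipowD; last exact: ipowM.
  by rewrite -scalerAl; apply: ipow_hbar; exact: ipow_mull.
Qed.

(** Isolates the summand without hbar. For n = 0 the predecessor is 0, so that I^(-1) is read as F;
    the same convention holds below. *)
Lemma ipow_decomp n x : ipow n x -> exists y z,
  [/\ ipow n.-1 y, jpow n z & x = hbar *: y + z].
Proof.
elim=> {n x} [n x hx|n x y _ [x1 [x2 [h1 h2 ->]]] _ [y1 [y2 [h3 h4 ->]]]|n x hx _].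
- exists 0, x; split=> //; first by apply: ipow_jpow; exact: jpow0.
  by rewrite scaler0 add0r.
- exists (x1 + y1), (x2 + y2); split; [exact: ipowD|exact: jpowD|].
  by rewrite scalerDr addrACA.
- by exists x, 0; split=> //; [exact: jpow0|rewrite addr0].
Qed.

Lemma modh_hbar x : modh (hbar *: x) = 0.
Proof. by rewrite modhZ scale0r. Qed.

Lemma ipow_order n x : ipow n x -> order_ge C n (modh x).
Proof.
elim=> {n x} [n x|n x y _ IHx _ IHy|n x _ _]; first exact: jpow_order.
  exact: order_geD.
by rewrite modh_hbar; exact: order_ge0.
Qed.

(** Uniform in the right factor: continuity of the product involves finitely many pairs of indices,
    and exact vanishing on their first components suffices. *)
Lemma wmul_small (A : set (wE F)) N : finite_set A ->
  exists B : set (wE F), finite_set B /\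
  forall x y, (forall e, B e -> x e = 0) -> small A N (x * y).
Proof.
move=> fA; have [|B [N' [fB hB]]] := @weak_contP _ _ _ _ (wmul F)
  [set u | small A N u] (@wmul_cont k F); first by exists A, N; split.
exists (fst @` B); split; first exact: finite_image.
move=> x y hx; apply: hB => -[e1 e2] Be; rewrite /wtens /= hx ?mul0r.
  exact: in_hbar0.
by exists (e1, e2).
Qed.

(* J^M tends to 0 in the weak topology.  As J^M tends to 0 mod hbar, one      *)
(* gains a power of hbar by writing an element of J^(M + M') as a sum of      *)
(* products: up to a first factor vanishing on a large finite set, it is      *)
(* hbar^N times an element of F J^M'.                                         *)
Lemma jpow_small (A : set (wE F)) N : finite_set A ->
  exists M, forall x, jpow M x -> small A N x.
Proof.
elim: N A => [|N IH] A fA; first by exists 0%N => x _ e _; exact: in_hbar00.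
have [B [fB hB]] := wmul_small N.+1 fA.
have [M1 hM1] := IH B fB; have [M2 hM2] := order_small C fA.
exists (M1 + M2)%N => z hz; apply: (jpow_split hz erefl).
- exact: small0.
- by move=> x y; exact: smallD.
move=> x y /hM1 /small_decomp[v [w [-> v0]]] hy.
have -> : (v + hbar ^+ N *: w : wring F) * y =
    (v : wring F) * y + hbar ^+ N *: ((w : wring F) * y).
  by rewrite mulrDl -scalerAl.
apply: smallD; first exact: hB.
have hwy : small A 1 ((w : wring F) * y).
  by apply: hM2; apply: jpow_order; exact: jpow_mull.
by move=> e /hwy h; rewrite -addn1; exact: (@in_hbar_scale _ _ 1 N _ h).
Qed.

Lemma hser_free : topologically_free ((hser k)^o : lmodType (hser k)).
Proof.
exists (k^o : lmodType k), (fun (f : hser k) n => f n); split=> //.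
by exists (fun f => f).
Qed.

Lemma eps_hbar x : eps (hbar *: x) = 0 -> eps x = 0.
Proof.
rewrite epsZ => e; apply: (hbar1_inj hser_free).
by rewrite scaler0 -[LHS]/(hbar * eps x).
Qed.

(** F is commutative modulo hbar; moreover eps kills commutators and k[[hbar]] has no torsion, so c
    itself lies in J. This keeps the loss in a swap to one factor of J. *)
Lemma commutator x y : exists2 c, eps c = 0 & x * y = y * x + hbar *: c.
Proof.
have [c e] : exists c, x * y = y * x + hbar *: c.
  by apply: modh_eqP; rewrite !modhM (mul0C C).
exists c => //; apply: eps_hbar; have := congr1 (@eps k F) e.
by rewrite epsD !epsM mulrC => /eqP; rewrite -subr_eq0 opprD addrA subrr add0r
   oppr_eq0 => /eqP.
Qed.

(** The constant lift, corrected so that eps vanishes exactly and not only modulo hbar. *)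
Definition aug_lift (u : kprod k (wE F)) : wring F :=
  (lifth u : wring F) - (eps (lifth u)) *: 1.

Lemma eps_aug_lift u : eps (aug_lift u) = 0.
Proof. by rewrite /aug_lift epsB epsZ eps1 mulr1 subrr. Qed.

Lemma modh_aug_lift u : order_ge C 1 u -> modh (aug_lift u) = u.
Proof.
move=> /tcoef00 hu; rewrite modhB modhZ (eps_modh C).
by rewrite [tcoef _ _ _]hu scale0r subr0.
Qed.

Definition var i : wring F := aug_lift (var0 C i).

Lemma eps_var i : eps (var i) = 0. Proof. exact: eps_aug_lift. Qed.
Lemma modh_var i : modh (var i) = var0 C i.
Proof. by apply: modh_aug_lift; exact: var0_order. Qed.

(** Modulo hbar, x minus its linear part has order 2, so it is a sum of products x_i v_i, whose
    factors lift to J. *)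
Lemma eps0_decomp x : eps x = 0 -> exists x' x'', jpow 2 x'' /\
  x = \sum_i hser_const (lin C i (modh x)) *: var i + (hbar *: x' + x'').
Proof.
move=> ex; have /order_ge_decomp[v [hv e]] := order_ge1_lin (eps_order ex).
pose x'' := \sum_i var i * aug_lift (v i).
have [|x' e'] := @modh_eqP _ _
    (x - \sum_i hser_const (lin C i (modh x)) *: var i) x''.
  rewrite modhB !modh_sum (eq_bigr (fun i => lin C i (modh x) *: var0 C i)).
    rewrite e; apply: eq_bigr => i _.
    by rewrite modhM modh_var modh_aug_lift.
  by move=> i _; rewrite modhZ modh_var.
exists x', x''; split.
  apply: jpow_sum => i; apply: jpowM; first exact: eps_var.
  by apply: jpow1; exact: eps_aug_lift.
rewrite [hbar *: _ + _]addrC -[x'' + hbar *: _ in RHS]e'.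
by rewrite addrC subrK.
Qed.

Definition wmon (w : seq 'I_d) : wring F := \prod_(i <- w) var i.

Lemma wmon_cons i w : wmon (i :: w) = var i * wmon w.
Proof. exact: big_cons. Qed.

Lemma wmon_cat w w' : wmon (w ++ w') = wmon w * wmon w'.
Proof. exact: big_cat. Qed.

Lemma wmon_jpow w : jpow (size w) (wmon w).
Proof.
elim: w => [|i w IH]; first exact: jpow_all.
by rewrite wmon_cons; apply: jpowM => //; exact: eps_var.
Qed.

Definition content (w : seq 'I_d) : mexp := [ffun i => count_mem i w].

Lemma mdeg_content w : mdeg (content w) = size w.
Proof.
elim: w => [|i w IH].
  by rewrite /mdeg big1 // => i _; rewrite ffunE.
rewrite /= -add1n -(mdeg_unit i) -IH /mdeg -big_split.
by apply: eq_bigr => j _; rewrite !ffunE /= eq_sym.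
Qed.

Lemma tcoef_wmon a w : tcoef C a (modh (wmon w)) = (a == content w)%:R.
Proof.
elim: w a => [|i w IH] a.
  rewrite /wmon big_nil -[modh _]/(one0 F) tcoef_one.
  have -> : content [::] = [ffun=> 0%N] by apply/ffunP => i; rewrite !ffunE.
  by case: eqP.
rewrite wmon_cons modhM modh_var tcoef_varM IH.
have cE j : content (i :: w) j = (mexp_unit i j + content w j)%N.
  by rewrite !ffunE /= eq_sym.
have [ai|ai] := posnP (a i).
  case: eqP => // e; move: ai; rewrite e cE ffunE eqxx; lia.
congr (nat_of_bool _)%:R; apply/eqP/eqP => e; apply/ffunP => j.
  by rewrite cE -e !ffunE subnKC //; case: eqP => // ->.
by rewrite [LHS]ffunE e cE addKn.
Qed.

Lemma perm_eq_content w w' : perm_eq w w' = (content w == content w').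
Proof.
apply/idP/eqP => [/permP e|e]; first by apply/ffunP => i; rewrite !ffunE.
apply/allP => i _ /=; have := congr1 (fun f : mexp => f i) e.
by rewrite !ffunE => ->.
Qed.

Definition hjpow n x := exists2 y, jpow n y & x = hbar *: y.

Lemma hjpowD n x y : hjpow n x -> hjpow n y -> hjpow n (x + y).
Proof.
by move=> [u hu ->] [v hv ->]; exists (u + v); [exact: jpowD|rewrite scalerDr].
Qed.

Lemma hjpow_mul m n x y : jpow m x -> hjpow n y -> hjpow (m + n) (x * y).
Proof.
by move=> hx [u hu ->]; exists (x * u); [exact: jpow_mul|rewrite scalerAr].
Qed.

Lemma hjpow_mulr m n x y : hjpow m x -> jpow n y -> hjpow (m + n) (x * y).
Proof.
by move=> [u hu ->] hy; exists (u * y); [exact: jpow_mul|rewrite scalerAl].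
Qed.

Lemma hjpowW m n x : (m <= n)%N -> hjpow n x -> hjpow m x.
Proof. by move=> mn [u hu ->]; exists u => //; exact: jpowW hu. Qed.

Lemma hjpow0 n : hjpow n 0.
Proof. by exists 0; [exact: jpow0|rewrite scaler0]. Qed.

(** Move x through w letter by letter: each swap trades two factors in J for hbar c with c in J. *)
Lemma commutator_wmon x w : eps x = 0 ->
  hjpow (size w) (x * wmon w - wmon w * x).
Proof.
move=> ex; elim: w => [|i w IH].
  by rewrite /wmon big_nil mulr1 mul1r subrr; exact: hjpow0.
have [c ec xi] := commutator x (var i).
have -> : x * wmon (i :: w) - wmon (i :: w) * x =
    (hbar *: c) * wmon w + var i * (x * wmon w - wmon w * x).
  rewrite wmon_cons mulrA xi mulrBr mulrDl !mulrA addrA.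
  by rewrite [_ * wmon w + _]addrC.
apply: hjpowD; last exact: (@hjpow_mul 1 _ _ _ (jpow1 (eps_var i)) IH).
apply: (@hjpow_mulr 1 _ _ _ _ (wmon_jpow w)).
by exists c => //; exact: jpow1.
Qed.

(** Bring the first letter of w to the front of w', at the cost of one [commutator_wmon], and use
    induction on the rest. *)
Lemma perm_wmon w w' : perm_eq w w' -> hjpow (size w).-1 (wmon w - wmon w').
Proof.
elim: w w' => [|i w IH] w' ww'.
  by rewrite perm_sym in ww'; rewrite (perm_nilP ww') subrr; exact: hjpow0.
have : i \in w' by rewrite -(perm_mem ww') mem_head.
move=> iw'; case/splitPr: iw' ww' => w1 w2.
rewrite -cat_rcons -cats1 -catA perm_sym perm_catCA /= perm_cons perm_sym => ww'.
have sw := perm_size ww'; rewrite size_cat in sw.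
have -> : wmon (i :: w) - wmon (w1 ++ i :: w2) =
   var i * (wmon w - wmon (w1 ++ w2)) +
     (var i * wmon w1 - wmon w1 * var i) * wmon w2.
  rewrite !wmon_cat !wmon_cons (mulrBr (var i)).
  by rewrite (mulrBl (wmon w2) (var i * wmon w1)) !mulrA addrA subrK.
apply: hjpowD.
  apply: (@hjpowW _ (1 + (size w).-1)); first by rewrite /=; lia.
  exact: (hjpow_mul (jpow1 (eps_var i)) (IH _ ww')).
rewrite /= sw; apply: hjpow_mulr; last exact: wmon_jpow.
exact: commutator_wmon (eps_var i).
Qed.

(** The subgroup hbar I^(n-1) + J^(n+1): its elements are zero in degree n modulo hbar. *)
Definition next_step n x := exists u v,
  [/\ ipow n.-1 u, jpow n.+1 v & x = hbar *: u + v].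

Lemma next_stepD n x y : next_step n x -> next_step n y -> next_step n (x + y).
Proof.
move=> [u [v [hu hv ->]]] [u' [v' [hu' hv' ->]]]; exists (u + u'), (v + v').
by split; [exact: ipowD|exact: jpowD|rewrite scalerDr addrACA].
Qed.

Lemma next_stepZ n c x : next_step n x -> next_step n (c *: x).
Proof.
move=> [u [v [hu hv ->]]]; exists (c *: u), (c *: v); split.
- by rewrite -mulr_algl; exact: ipow_mull.
- exact: jpowZ.
- by rewrite scalerDr !scalerA mulrC.
Qed.

Lemma next_step0 n : next_step n 0.
Proof.
exists 0, 0; split; [by apply: ipow_jpow; exact: jpow0|exact: jpow0|].
by rewrite scaler0 addr0.
Qed.

Lemma next_step_hjpow n x : hjpow n.-1 x -> next_step n x.
Proof.
move=> [u hu ->]; exists u, 0; split; [exact: ipow_jpow|exact: jpow0|].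
by rewrite addr0.
Qed.

Lemma next_step_jpow n x : jpow n.+1 x -> next_step n x.
Proof.
move=> hx; exists 0, x; split=> //; first by apply: ipow_jpow; exact: jpow0.
by rewrite scaler0 add0r.
Qed.

Lemma next_step_ipow n x : ipow n.-1 x -> next_step n (hbar *: x).
Proof. by move=> hx; exists x, 0; split=> //; [exact: jpow0|rewrite addr0]. Qed.

Lemma big_tupleS (R : nmodType) (T : finType) n (G : n.+1.-tuple T -> R) :
  \sum_t G t = \sum_i \sum_(t : n.-tuple T) G [tuple of i :: t].
Proof.
rewrite pair_big /= (reindex (fun p : T * n.-tuple T => [tuple of p.1 :: p.2])) //=.
exists (fun t => (thead t, [tuple of behead t])) => [[i t] _|t _].
  by rewrite /= theadE; congr pair; exact: val_inj.
by rewrite -tuple_eta.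
Qed.

(** Replace each factor in J by its linear part from [eps0_decomp]. Words are not yet sorted here,
    so the coefficients need not be unique. *)
Lemma jpow_wmon n z : jpow n z -> exists c : n.-tuple 'I_d -> k,
  next_step n (z - \sum_t hser_const (c t) *: wmon t).
Proof.
elim=> {n z} [z|n|n x y _ [c1 h1] _ [c2 h2]|n x y ex hy [c hc]].
- exists (fun=> tcoef C [ffun=> 0%N] (modh z)).
  rewrite (big_pred1 [tuple]) /=; last first.
    by move=> t; rewrite [t]tuple0 /= eqxx.
  rewrite /wmon big_nil.
  set y := z - _; have hy : order_ge C 1 (modh y).
    apply/tcoef00; rewrite modhB modhZ tcoefB tcoefZ.
    by rewrite -[modh (1 : wring F)]/(one0 F) tcoef_one eqxx mulr1 subrr.
  have [u ->] := modh_eqP (esym (modh_aug_lift hy)).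
  rewrite addrC; apply: next_stepD; first by apply: next_step_ipow; exact: ipow_all.
  by apply: next_step_jpow; apply: jpow1; exact: eps_aug_lift.
- exists (fun=> 0); rewrite big1 ?subrr; first exact: next_step0.
  by move=> t _; rewrite raddf0 scale0r.
- exists (fun t => c1 t + c2 t).
  rewrite (eq_bigr (fun t : n.-tuple 'I_d => hser_const (c1 t) *: wmon t +
    hser_const (c2 t) *: wmon t)); last by move=> t _; rewrite raddfD scalerDl.
  by rewrite big_split opprD addrACA; exact: next_stepD.
- have [x' [x'' [hx'' xE]]] := eps0_decomp ex.
  set Y := \sum_t _ in hc.
  have hY : jpow n Y.
    apply: jpow_sum => t; apply: jpowZ.
    by rewrite -[n in jpow n](size_tuple t); exact: wmon_jpow.
  exists (fun t => lin C (thead t) (modh x) * c [tuple of behead t]).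
  rewrite big_tupleS.
  have -> : \sum_i \sum_(t : n.-tuple 'I_d)
      hser_const (lin C (thead [tuple of i :: t]) (modh x) *
         c [tuple of behead [tuple of i :: t]]) *: wmon [tuple of i :: t] =
      (\sum_i hser_const (lin C i (modh x)) *: var i) * Y.
    rewrite mulr_suml; apply: eq_bigr => i _; rewrite mulr_sumr.
    apply: eq_bigr => t _; rewrite theadE wmon_cons rmorphM -scalerA.
    rewrite -scalerAl -scalerAr; congr (_ *: (hser_const (c _) *: _)).
    exact: val_inj.
  set L := \sum_i _ in xE *.
  have xL : hbar *: x' + x'' = x - L by rewrite {1}xE [L + _]addrC addrK.
  (* Three errors: the one of y multiplied by x, and the two parts of x - L multiplied by Y. *)
  have -> : x * y - L * Y = x * (y - Y) + (hbar *: (x' * Y) + x'' * Y).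
    by rewrite scalerAl -mulrDl xL mulrBr (mulrBl Y x L) addrA subrK.
  case: hc => u [v [hu hv ->]].
  apply: next_stepD; last apply: next_stepD.
  + rewrite mulrDr -scalerAr; apply: next_stepD.
      apply: next_step_ipow => /=.
      have [->|/prednK <-] := posnP n; [exact: ipow_all|exact: ipowM].
    by apply: next_step_jpow; exact: jpowM.
  + by apply: next_step_ipow; apply: ipow_jpow; exact: jpow_mull.
  + by apply: next_step_jpow; exact: (@jpow_mul 2).
Qed.

(* the coefficients of the monomials of degree n in z are determined by the   *)
(* class of z modulo hbar, up to the order of the factors of the monomials,   *)
(* which only matters up to hbar J^(n - 1)                                    *)
Lemma jpow_next n z : jpow n z -> order_ge C n.+1 (modh z) -> next_step n z.
Proof.
move=> hz ordz; have [c [u [v [hu hv zE]]]] := jpow_wmon hz.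
have uv : next_step n (hbar *: u + v) by exists u, v.
rewrite -(subrK (\sum_t hser_const (c t) *: wmon t) z) zE.
apply: next_stepD => //.
(* Modulo hbar all rearrangements of t0 give one monomial, whose coefficient in z is the sum of
   theirs; it vanishes because z has order n+1. *)
have sum0 (t0 : n.-tuple 'I_d) :
    \sum_(t : n.-tuple 'I_d | perm_eq t t0) c t = 0.
  have : tcoef C (content t0) (modh (z - (hbar *: u + v))) = 0.
    rewrite modhB modhD modh_hbar add0r tcoefB ordz ?mdeg_content ?size_tuple //.
    by rewrite (jpow_order hv) ?subrr // mdeg_content size_tuple.
  rewrite -zE opprB addrC subrK modh_sum tcoef_sum => e; rewrite -[RHS]e.
  rewrite [LHS]big_mkcond; apply: eq_bigr => t _.
  rewrite modhZ tcoefZ tcoef_wmon perm_eq_content eq_sym.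
  by case: eqP => _; rewrite ?mulr1 ?mulr0.
pose le (i j : 'I_d) := (i <= j)%N.
have sortP : forall s t, reflect (sort le s = sort le t) (perm_eq s t).
  apply: perm_sortP => [i j|i j l|i j /anti_leq /val_inj //].
    exact: leq_total.
  exact: leq_trans.
(* Sort every word, up to hbar J^(n-1), and then collect equal words: the total coefficients are the
   sums of [sum0]. *)
pose f (t : n.-tuple 'I_d) : n.-tuple 'I_d := [tuple of sort le t].
rewrite -(subrK (\sum_t hser_const (c t) *: wmon (f t))
   (\sum_t hser_const (c t) *: wmon t)).
apply: next_stepD.
  rewrite -sumrB; elim/big_ind: _ => [||t _]; first exact: next_step0.
    by move=> x y; exact: next_stepD.
  rewrite -scalerBr; apply: next_stepZ; apply: next_step_hjpow.
  rewrite -[n in n.-1](size_tuple t); apply: perm_wmon.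
  by rewrite perm_sym perm_sort.
suff -> : \sum_t hser_const (c t) *: wmon (f t) = 0 by exact: next_step0.
rewrite (partition_big f xpredT) // big1 // => s _.
rewrite (eq_bigr (fun t : n.-tuple 'I_d => hser_const (c t) *: wmon s)); last first.
  by move=> t /eqP ->.
rewrite -scaler_suml -rmorph_sum /=.
have [/existsP[t0 /eqP <-]|/existsPn no_t] := boolP [exists t, f t == s].
  rewrite (eq_bigl (fun t : n.-tuple 'I_d => perm_eq t t0)).
    by rewrite sum0 raddf0 scale0r.
  by move=> t; rewrite -val_eqE /=; apply/eqP/idP => /sortP.
by rewrite big_pred0 ?raddf0 ?scale0r // => t; apply/negbTE/no_t.
Qed.

(** Iterates [jpow_next]: each step moves the remainder without hbar into the next power of J. *)
Lemma jpow_divide n M z : (n <= M)%N -> jpow n z -> order_ge C M (modh z) ->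
  exists y z', [/\ ipow n.-1 y, jpow M z' & z = hbar *: y + z'].
Proof.
move=> /subnKC <-; move: (M - n)%N => m; elim: m n z => [|m IH] n z.
  rewrite addn0 => hz _; exists 0, z; split=> //; last by rewrite scaler0 add0r.
  by apply: ipow_jpow; exact: jpow0.
move=> hz ordz.
have [|u [v [hu hv zE]]] := jpow_next hz.
  by apply: order_geW ordz; lia.
have [|y [z' [hy hz' vE]]] := IH n.+1 v hv.
  move: ordz; rewrite zE modhD modh_hbar add0r; apply: order_geW; lia.
exists (u + y), z'; split; last by rewrite zE vE scalerDr addrA.
  by apply: ipowD => //; exact: ipow_pred.
by rewrite addnS -addSn.
Qed.

(** Membership in the weak closure of I^n. The closure absorbs the remainder that [jpow_divide]
    leaves in J^M. *)
Definition ipow_closure n x := forall (A : set (wE F)) N, finite_set A ->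
  exists y, ipow n y /\ small A N (x - y).

(** Approximate hbar x by hbar u + z with z in J^(n+1). Modulo hbar, z is close to 0, so
    [jpow_divide] makes it a multiple of hbar up to a small element of J^M; then hbar can be
    cancelled. *)
Lemma ipow_closureS n x : ipow_closure n.+1 (hbar *: x) -> ipow_closure n x.
Proof.
move=> hx A N fA; have [M0 hM0] := jpow_small N.+1 fA.
(* J^M is small on A, and closeness to 0 on B forces order M modulo hbar. *)
pose M := maxn n.+1 M0; have [B [fB hB]] := small_order C M.
have [|y [hy hxy]] := hx (A `|` B) N.+1; first by rewrite finite_setU.
have [u [z [hu hz yE]]] := ipow_decomp hy.
have ordz : order_ge C M (modh z).
  have -> : z = - (hbar *: x - y) + hbar *: (x - u).
    by rewrite yE scalerBr opprD opprK addrACA addNr add0r addrC addKr.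
  rewrite modhD modh_hbar addr0 modhN; apply: order_geN; apply: hB.
  by apply: smallW hxy => // e Be; right.
have [u' [z' [hu' hz' zE]]] := jpow_divide (leq_maxl _ _) hz ordz.
exists (u + u'); split; first exact: ipowD.
have : small A N.+1 (hbar *: (x - (u + u'))).
  have -> : hbar *: (x - (u + u')) = hbar *: x - y + z'.
    by rewrite yE zE scalerBr scalerDr addrA [- (_ + z')]opprD addrA subrK.
  apply: smallD; first by apply: smallW hxy => // e Ae; left.
  by apply: hM0; apply: jpowW hz'; exact: leq_maxr.
move=> h e /h; rewrite -add1n; exact: (in_hbar_cancel hser_free).
Qed.

Lemma ipow_closure_order n x : ipow_closure n x -> order_ge C n (modh x).
Proof.
move=> hx a an; have [A [fA hA]] := tcoef_continuous a.
have [y [hy /modh_small hxy]] := hx A 1%N fA.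
rewrite -(subrK y x) modhD tcoefD hA // add0r; exact: (ipow_order hy).
Qed.

Lemma ipow_hbar_order m n x : ipow (m + n) (hbar ^+ m *: x) ->
  order_ge C n (modh x).
Proof.
move=> hx; apply: ipow_closure_order.
have : ipow_closure (m + n) (hbar ^+ m *: x).
  by move=> A N _; exists (hbar ^+ m *: x); rewrite subrr; split=> //; exact: small0.
elim: m {hx} => [|m IH]; first by rewrite expr0 scale1r.
by rewrite addSn exprS -scalerA => /ipow_closureS.
Qed.

End Filtrations.

(** * Completed tensor products *)

(** A maximal subspace A avoiding v is a complement of the line k v; the form is the coordinate
    along v. *)
Lemma linear_form_exists (k : fieldType) (V : lmodType k) (v : V) : v != 0 ->
  exists m : V -> k^o, linear m /\ m v != 0.
Proof.
move=> v0.
pose P (W : set V) := (forall c x y, W x -> W y -> W (c *: x + y)) /\ ~ W v.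
have [|A [[Alin Av] Amax]] := @Zorn_bigcup V P.
  move=> G GP Gtot; split; last by move=> [W GW Wv]; case: (GP _ GW).
  move=> c x y [W GW Wx] [W' GW' W'y].
  have [WW'|W'W] := Gtot _ _ GW GW'.
    by exists W' => //; apply: (GP _ GW').1 => //; exact: WW'.
  by exists W => //; apply: (GP _ GW).1 => //; exact: W'W.
have AB c x y : A x -> A y -> A (c *: x - y).
  move=> Ax Ay; have A0 : A 0 by have := Alin (-1) x x Ax Ax; rewrite scaleN1r addNr.
  by apply: (Alin) => //; rewrite -scaleN1r -[_ *: y]addr0; exact: Alin.
(* [P] holds of the empty set, as the union of the empty chain requires. A maximal set without 0
   would be empty, and the zero subspace is larger. *)
have A0 : A 0.
  have [//|nA0] := pselect (A 0); exfalso.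
  have Ae x : ~ A x by move=> Ax; have := AB 1 x x Ax Ax; rewrite scale1r subrr.
  apply: (Amax [set 0]); first by split=> [|/(_ 0 erefl)//] x /Ae.
  split=> [c x y -> ->|/esym/eqP]; first by rewrite scaler0 addr0.
  by rewrite eq_sym (negPf v0).
have AZ c x : A x -> A (c *: x) by move=> Ax; rewrite -[_ *: x]addr0; exact: Alin.
have AvZ c : A (c *: v) -> c = 0.
  move=> Acv; apply/eqP; apply: contrapT => /negP c0; apply: Av.
  by rewrite -[v]scale1r -(mulVf c0) -scalerA; exact: AZ.
have /choice[m hm] x : exists c, A (x - c *: v).
  have [Ax|nAx] := pselect (A x); first by exists 0; rewrite scale0r subr0.
  (* By maximality A + k x contains v, which expresses x through A and v. *)
  pose B := [set y | exists a c, A a /\ y = a + c *: x].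
  have [a [c [Aa vE]]] : B v.
    apply: contrapT => nBv; apply: (Amax B).
      split=> [y Ay|BA]; first by exists y, 0; rewrite scale0r addr0.
      by apply: nAx; apply: BA; exists 0, 1; rewrite scale1r add0r.
    split=> // c _ _ [a [e [Aa ->]]] [a' [e' [Aa' ->]]].
    exists (c *: a + a'), (c * e + e'); split; first exact: Alin.
    by rewrite scalerDr scalerDl scalerA addrACA.
  have c0 : c != 0.
    by apply/eqP => c0; apply: Av; rewrite vE c0 scale0r addr0.
  exists c^-1; rewrite vE scalerDr scalerA mulVf // scale1r opprD addrCA subrr.
  by rewrite addr0 -scaleNr; exact: AZ.
exists m; split.
  move=> c x y; apply/eqP; rewrite -subr_eq0; apply/eqP; apply: AvZ.
  have := AB 1 _ _ (Alin c _ _ (hm x) (hm y)) (hm (c *: x + y)).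
  congr A; rewrite scale1r scalerBl scalerDl scalerBr scalerA opprB.
  by rewrite (addrACA (c *: x)) -opprD [LHS]addrC [LHS]addrA subrK.
by apply/eqP => mv; apply: Av; have := hm v; rewrite mv scale0r subr0.
Qed.

Section Free.
Variables (k : fieldType) (M : lmodType (hser k)).
Hypothesis freeM : topologically_free M.

(** Apply to every coefficient a linear form on V that detects a nonzero coefficient of x below
    hbar^N. *)
Lemma dual_separates N (x : M) : ~ in_hbar N x ->
  exists m : M -> (hser k)^o, linear m /\ ~ in_hbar N (m x).
Proof.
have [V [f [fbij fl _ fin]]] := free_coordinates freeM.
move=> nx; have [n [nN fx]] : exists n, (n < N)%N /\ f x n != 0.
  apply: contrapT => h; apply: nx; apply/fin => n nN.
  by apply/eqP; apply: contrapT => /negP fx; apply: h; exists n.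
have [m [ml mx]] := linear_form_exists fx.
pose mB := GRing.isLinear.Build _ _ _ _ m ml.
pose mL : {linear V -> k^o} := HB.pack m mB.
exists (fun y n => mL (f y n)); split.
  move=> a y z; apply/funext => l; rewrite fl linearD linear_sum.
  by congr (_ + _); apply: eq_bigr => i _; rewrite linearZZ.
by move=> /hser_in_hbarP /(_ n nN) /eqP; rewrite (negPf mx).
Qed.

End Free.

Section CompletedTensor.
Variables (k : fieldType) (M N T : lmodType (hser k)) (t : M -> N -> T).
Hypothesis tP : is_completed_tensor t.

Lemma tensor_liftP (P : lmodType (hser k)) (b : M -> N -> P) :
  topologically_free P -> bilinear_map b ->
  linear (tensor_lift t b) /\ forall x y, tensor_lift t b (t x y) = b x y.
Proof.
case: tP => _ _ univ freeP hb; have [f [hf _]] := univ _ b freeP hb.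
by rewrite /tensor_lift; case: xgetP => [g _ //|nof]; case: (nof f).
Qed.

Lemma tensor_eq (P : lmodType (hser k)) (f g : T -> P) :
  topologically_free P -> linear f -> linear g ->
  (forall x y, f (t x y) = g (t x y)) -> forall u, f u = g u.
Proof.
case: tP => _ [tl tr] univ freeP lf lg fg u.
have hb : bilinear_map (fun x y => f (t x y)).
  by split=> [y a x x'|x a y y'] /=; rewrite ?[t (_ + _) _]tl ?[t _ (_ + _)]tr lf.
have [h [_ hu]] := univ _ _ freeP hb.
by rewrite -(hu f (conj lf _)) // -(hu g (conj lg _)) // => x y; rewrite fg.
Qed.

Lemma tensor_sumr x (I : Type) (s : seq I) (y : I -> N) :
  t x (\sum_(i <- s) y i) = \sum_(i <- s) t x (y i).
Proof.
case: tP => _ [_ tr] _; elim: s => [|i s IH].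
  rewrite !big_nil; have := tr x (-1) 0 0.
  by rewrite scaler0 addr0 scaleN1r addNr.
rewrite !big_cons -IH; have := tr x 1 (y i) (\sum_(i <- s) y i).
by rewrite !scale1r.
Qed.

Lemma tensor_suml y (I : Type) (s : seq I) (x : I -> M) :
  t (\sum_(i <- s) x i) y = \sum_(i <- s) t (x i) y.
Proof.
case: tP => _ [tl _] _; elim: s => [|i s IH].
  rewrite !big_nil; have := tl y (-1) 0 0.
  by rewrite scaler0 addr0 scaleN1r addNr.
rewrite !big_cons -IH; have := tl y 1 (x i) (\sum_(i <- s) x i).
by rewrite !scale1r.
Qed.

Lemma tensorDl x x' y : t (x + x') y = t x y + t x' y.
Proof. by case: tP => _ [tl _] _; have := tl y 1 x x'; rewrite !scale1r. Qed.
Lemma tensorDr x y y' : t x (y + y') = t x y + t x y'.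
Proof. by case: tP => _ [_ tr] _; have := tr x 1 y y'; rewrite !scale1r. Qed.
Lemma tensor0l y : t 0 y = 0.
Proof. by have := @tensor_suml y nat [::] (fun=> 0); rewrite !big_nil. Qed.
Lemma tensor0r x : t x 0 = 0.
Proof. by have := @tensor_sumr x nat [::] (fun=> 0); rewrite !big_nil. Qed.
Lemma tensorZl a x y : t (a *: x) y = a *: t x y.
Proof.
by case: tP => _ [tl _] _; have := tl y a x 0; rewrite /= tensor0l !addr0.
Qed.
Lemma tensorZr a x y : t x (a *: y) = a *: t x y.
Proof.
by case: tP => _ [_ tr] _; have := tr x a y 0; rewrite tensor0r !addr0.
Qed.
Lemma tensorBl x x' y : t (x - x') y = t x y - t x' y.
Proof. by rewrite tensorDl -scaleN1r tensorZl scaleN1r. Qed.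
Lemma tensorBr x y y' : t x (y - y') = t x y - t x y'.
Proof. by rewrite tensorDr -scaleN1r tensorZr scaleN1r. Qed.

Lemma tensor_in_hbar n m x y :
  in_hbar n x -> in_hbar m y -> in_hbar (n + m) (t x y).
Proof.
move=> [x' ->] [y' ->]; rewrite tensorZl tensorZr scalerA -exprD.
exact: in_hbar_hbar.
Qed.

End CompletedTensor.

Section Flip.
Variables (k : fieldType) (U : hHopf k).

Let t2P := ht2P U.
Lemma hfree2 : topologically_free (hH2 U). Proof. by case: t2P. Qed.

Lemma ht2_bilinear_flip : bilinear_map (fun x y => ht2 U y x).
Proof. by case: t2P => _ [tl tr] _; split. Qed.

Lemma hflip_linear : linear (@hflip k U).
Proof. exact: (tensor_liftP t2P hfree2 ht2_bilinear_flip).1. Qed.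

HB.instance Definition _ :=
  GRing.isLinear.Build (hser k) (hH2 U) (hH2 U) *:%R (@hflip k U) hflip_linear.

Lemma hflip_tensor x y : hflip (ht2 U x y) = ht2 U y x.
Proof. exact: (tensor_liftP t2P hfree2 ht2_bilinear_flip).2. Qed.

Lemma hflip1 : hflip (1 : hH2 U) = 1.
Proof. by rewrite -ht2_1 hflip_tensor. Qed.

Lemma hflipM (u v : hH2 U) : hflip (u * v) = hflip u * hflip v.
Proof.
move: v; apply: (tensor_eq t2P hfree2).
- by move=> a v w; rewrite mulrDr -scalerAr linearP.
- by move=> a v w; rewrite linearP mulrDr -scalerAr.
move=> x y; move: u; apply: (tensor_eq t2P hfree2).
- by move=> a v w; rewrite mulrDl -scalerAl linearP.
- by move=> a v w; rewrite linearP mulrDl -scalerAl.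
by move=> x' y'; rewrite ht2_M !hflip_tensor ht2_M.
Qed.

End Flip.

(** * Approximation by finite sums of tensors *)

Section Density.
Variables (k : fieldType) (F : wHopf k).
Local Notation E := (wE F).
Implicit Types (u v w : wF2 k F) (x y : wring F).
Implicit Types (s : seq (wF k F * wF k F)).

Definition tsum s : wF2 k F := \sum_(q <- s) wtens q.1 q.2.

(** Positions are corrected one at a time by a multiple of a matrix unit, which leaves the other
    positions alone. *)
Lemma tsum_dense u (A : set (E * E)) : finite_set A ->
  exists s, forall p, A p -> (u - tsum s) p = 0.
Proof.
move=> /(@finite_seqP {classic (E * E)})[r ->].
elim: r => [|p r [s hs]]; first by exists [::].
pose delta (e : E) : wF k F := fun e' => if `[< e = e' >] then 1 else 0.
exists ((((u - tsum s) p) *: delta p.1, delta p.2) :: s) => q /=.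
rewrite inE /tsum big_cons opprD addrCA addrC.
rewrite [LHS](_ : _ = (u - tsum s) q -
  wtens ((u - tsum s) p *: delta p.1) (delta p.2) q) //.
rewrite wtensZl [(_ *: wtens _ _) q](_ : _ =
  (u - tsum s) p * (delta p.1 q.1 * delta p.2 q.2)) //.
move=> qr; have [qp|qp] := pselect (p = q).
  by rewrite -qp /delta !asboolT // !mulr1 subrr.
have -> : delta p.1 q.1 * delta p.2 q.2 = 0 :> hser k.
  rewrite /delta; case: asboolP => [e1|_]; last by rewrite mul0r.
  case: asboolP => [e2|_]; last by rewrite mulr0.
  by case: qp; rewrite [p]surjective_pairing [q]surjective_pairing e1 e2.
rewrite mulr0 subr0; case/predU1P: qr => [/esym/qp//|]; exact: hs.
Qed.

Definition eps_l u : wF k F := fun e => eps ((fun e' => u (e', e)) : wF k F).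
Definition eps_r u : wF k F := fun e => eps ((fun e' => u (e, e')) : wF k F).

Lemma wflipK u : wflip (wflip u) = u.
Proof. by apply/funext => -[]. Qed.

Lemma wflip_wtens x y : wflip (wtens x y) = wtens y x.
Proof. by apply/funext => p; exact: mulrC. Qed.

Lemma wflip_sum (I : Type) (r : seq I) (f : I -> wF2 k F) :
  wflip (\sum_(i <- r) f i) = \sum_(i <- r) wflip (f i).
Proof. by elim: r => [|i r IH]; rewrite ?big_nil // !big_cons -IH. Qed.

Lemma eps_l_flip u : eps_l (wflip u) = eps_r u. Proof. by []. Qed.
Lemma eps_r_flip u : eps_r (wflip u) = eps_l u. Proof. by []. Qed.

Lemma eps_l_linear a u v : eps_l (a *: u + v) = a *: eps_l u + eps_l v.
Proof. by apply/funext => e; exact: linearP. Qed.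

Lemma eps_lB u v : eps_l (u - v) = eps_l u - eps_l v.
Proof. by rewrite addrC -scaleN1r eps_l_linear scaleN1r addrC. Qed.

Lemma eps_l_wtens x y : eps_l (wtens x y) = eps x *: (y : wF k F).
Proof.
apply/funext => e; rewrite /eps_l.
have -> : (fun e' => wtens x y (e', e)) = (y e : hser k) *: (x : wF k F).
  by apply/funext => e'; exact: mulrC.
by rewrite [LHS](epsZ (y e) x) mulrC.
Qed.

Lemma eps_l_tsum s : (forall q, q \in s -> eps q.1 = 0) -> eps_l (tsum s) = 0.
Proof.
elim: s => [_|q s IH hs]; first by rewrite /tsum big_nil -(subrr 0) eps_lB subrr.
rewrite /tsum big_cons -[wtens _ _]scale1r eps_l_linear eps_l_wtens.
rewrite hs ?mem_head // scale0r scaler0 add0r.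
by apply: IH => r rs; apply: hs; rewrite inE rs orbT.
Qed.

Lemma eps_r_tsum s : (forall q, q \in s -> eps q.2 = 0) -> eps_r (tsum s) = 0.
Proof.
move=> hs; rewrite -eps_l_flip.
have -> : wflip (tsum s) = tsum [seq (q.2, q.1) | q <- s].
  by rewrite /tsum wflip_sum big_map; apply: eq_bigr => q _; rewrite wflip_wtens.
by apply: eps_l_tsum => q /mapP[r /hs er ->].
Qed.

Lemma eps_rB u v : eps_r (u - v) = eps_r u - eps_r v.
Proof. exact: eps_lB (wflip u) (wflip v). Qed.

Lemma eps_small N : exists (A : set E) M, finite_set A /\
  forall x, small A M x -> in_hbar N (eps x : (hser k)^o).
Proof.
have nbhsN : hbar_nbhs0 (in_hbar (M := (hser k)^o) N) by exists N.
exact: weak_contP (@wcou_cont k F) nbhsN.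
Qed.

(** The projection (id - eps 1) (x) id onto Ker(eps) (x) F, given by a formula valid on the whole
    completed tensor square. *)
Definition aug_proj u := u - wtens (wone F) (eps_l u).

Lemma aug_proj_linear a u v :
  aug_proj (a *: u + v) = a *: aug_proj u + aug_proj v.
Proof.
rewrite /aug_proj eps_l_linear wtensDr wtensZr scalerBr opprD.
by rewrite addrACA.
Qed.

Lemma aug_proj_id u : eps_l u = 0 -> aug_proj u = u.
Proof.
by move=> u0; rewrite /aug_proj u0 -[0](scale0r 0) wtensZr !scale0r subr0.
Qed.

Lemma aug_proj_wtens x y : aug_proj (wtens x y) = wtens (x - eps x *: 1 : wring F) y.
Proof.
rewrite /aug_proj eps_l_wtens wtensZr -wtensZl.
by apply/funext => p; rewrite /wtens mulrBl.
Qed.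

Lemma aug_proj_small (A : set (E * E)) N : finite_set A ->
  exists (B : set (E * E)) M, finite_set B /\
    forall u, small B M u -> small A N (aug_proj u).
Proof.
move=> fA; have [D [M [fD hD]]] := eps_small N.
exists (A `|` (D `*` (snd @` A))), (maxn N M); split.
  rewrite finite_setU; split=> //; apply: finite_setX => //; exact: finite_image.
move=> u hu [e1 e2] Ae; apply: in_hbarB.
  by apply: in_hbarW (hu _ _); [exact: leq_maxl|left].
apply: (@in_hbarZ _ _ _ (wone F e1)); apply: hD => e De.
apply: in_hbarW (hu _ _); first exact: leq_maxr.
by right; split=> //; exists (e1, e2).
Qed.

(* apply to an approximation of u the projection of F (x) F onto              *)
(* Ker(eps) (x) Ker(eps), which fixes u                                       *)
Lemma tsum_dense_aug u (A : set (E * E)) N : finite_set A ->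
  eps_l u = 0 -> eps_r u = 0 ->
  exists s, (forall q, q \in s -> eps q.1 = 0 /\ eps q.2 = 0) /\
    small A N (u - tsum s).
Proof.
move=> fA ul ur; pose proj v := aug_proj (wflip (aug_proj (wflip v))).
have proj_linear a v w : proj (a *: v + w) = a *: proj v + proj w.
  rewrite /proj -[wflip (a *: v + w)]/(a *: wflip v + wflip w).
  rewrite (aug_proj_linear a (wflip v)).
  exact: (aug_proj_linear a (wflip (aug_proj (wflip v)))).
have proj0 : proj 0 = 0.
  have := proj_linear (-1) 0 0.
  by rewrite scaler0 addr0 scaleN1r addNr.
have projD v w : proj (v + w) = proj v + proj w.
  by have := proj_linear 1 v w; rewrite !scale1r.
have proju : proj u = u.
  by rewrite /proj (aug_proj_id (u := wflip u)) ?wflipK ?aug_proj_id.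
have [B [M [fB hB]]] := aug_proj_small N fA.
have [D [M' [fD hD]]] := aug_proj_small M (finite_image (fun p => (p.2, p.1)) fB).
have [s hs] := tsum_dense u (finite_image (fun p => (p.2, p.1)) fD).
pose red x : wring F := x - eps x *: 1.
have eps_red x : eps (red x) = 0 by rewrite epsB epsZ eps1 mulr1 subrr.
exists [seq (red q.1, red q.2) | q <- s]; split.
  by move=> q /mapP[r _ ->] /=.
have -> : tsum [seq (red q.1, red q.2) | q <- s] = proj (tsum s).
  rewrite /tsum big_map (big_morph proj projD proj0); apply: eq_bigr => q _ /=.
  rewrite /proj wflip_wtens aug_proj_wtens wflip_wtens aug_proj_wtens.
  by [].
rewrite -{1}proju.
have -> : proj u - proj (tsum s) = proj (u - tsum s).
  by rewrite projD -[- tsum s]scaleN1r -[_ *: _]addr0 proj_linear proj0 addr0 scaleN1r.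
apply: hB => -[e1 e2] Be; apply: (hD (wflip (u - tsum s))); last by exists (e1, e2).
move=> [e3 e4] De; rewrite /wflip hs; first exact: in_hbar0.
by exists (e3, e4).
Qed.

End Density.

(** * The maps from F and its tensor square to the Drinfeld dual *)

Section DrinfeldDual.
Variables (k : fieldType) (F : wHopf k) (C : chart F) (U : hHopf k).
Variables (iota : {linear wF k F -> hH U}) (j : {linear wF2 k F -> hH2 U}).
Hypothesis dual : is_Drinfeld_dual iota j.
Local Notation E := (wE F).
Implicit Types (u v w : wF2 k F) (x y : wring F).

Let freeU : topologically_free (hH U) := hfree U.
Let freeU2 : topologically_free (hH2 U) := hfree2 U.
Let t2P := ht2P U.

Lemma iotaM x y : iota (x * y) = iota x * iota y.
Proof. exact: dr_mul dual x y. Qed.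

Lemma iota_aug x : eps x = 0 -> in_hbar 1 (iota x).
Proof.
move=> ex; apply: (dr_dom dual (n := 1)); exists [:: (x, wone F)]; split.
  move=> p; rewrite inE => /eqP -> /=; split=> //; exists 0, x.
  by rewrite scaler0 add0r.
by rewrite big_seq1 wmul1r.
Qed.

Lemma iota_jpow n x : jpow n x -> in_hbar n (iota x).
Proof.
elim=> {n x} [x|n|n x y _ hx _ hy|n x y ex _ IH].
- exact: in_hbar00.
- by rewrite linear0; exact: in_hbar0.
- by rewrite linearD; exact: in_hbarD.
- by rewrite iotaM -add1n; apply: in_hbarM => //; exact: iota_aug.
Qed.

(** [dr_sep] gives hbar^m x = hbar^N y with y in I^m, hence hbar^m x lies in I^(m+N), and
    [ipow_hbar_order] cancels hbar^m. *)
Lemma iota_order N x : in_hbar N (iota x) -> order_ge C N (modh x).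
Proof.
move=> hx; have [|m [y [hy e]]] := dr_sep dual (n := 0) (x := x) (N := N) I.
  by rewrite (@hdivE _ _ freeU 0 _ (iota x)) // expr0 scale1r.
apply: (@ipow_hbar_order _ _ C m); rewrite [_ *: _]e add0n addnC.
by apply: ipow_hbarX; exact: aug_ideal_pow_ipow.
Qed.

(** Such an x has infinite order modulo hbar, so x = hbar x'; as U has no torsion, x' is again in
    the kernel, and x is divisible by every power of hbar. *)
Lemma iota_inj x : iota x = 0 -> x = 0.
Proof.
move=> ix; apply: (in_hbar_eq0 (wprod_free k E)) => N.
elim: N x ix => [|N IH] x ix; first exact: in_hbar00.
have [x' xE] : in_hbar 1 (x : wF k F).
  apply/modh_eq0; apply: (@tcoef_inj _ _ C) => a; rewrite tcoef0.
  apply: (iota_order (N := (mdeg a).+1)) => //; rewrite ix; exact: in_hbar0.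
rewrite xE -add1n; apply: in_hbar_scale; apply: IH.
by apply: (hbar_inj freeU (N := 1)); rewrite scaler0 -linearZZ -xE.
Qed.

Lemma j_small N : exists (A : set (E * E)) M, finite_set A /\
  forall u, small A M u -> in_hbar N (j u).
Proof.
have nbhsN : hbar_nbhs0 (in_hbar (M := hH2 U) N) by exists N.
exact: weak_contP (dr_j_cont dual) nbhsN.
Qed.

(** Continuity of [iota] follows from that of [j]: [iota] is x -> j (x (x) 1) followed by id (x)
    counit. *)
Lemma iota_small N : exists (A : set E) M, finite_set A /\
  forall x, small A M x -> in_hbar N (iota x).
Proof.
have [A [M [fA hA]]] := j_small N.
exists (fst @` A), M; split; first exact: finite_image.
move=> x hx; pose b (y z : hH U) : hH U := (hcou U z : hser k) *: y.
have hb : bilinear_map b.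
  split=> [z a y y'|y a z z']; rewrite /b.
    by rewrite scalerDr !scalerA mulrC.
  by rewrite linearP scalerDl -scalerA.
have [lb bE] := tensor_liftP t2P freeU hb.
have -> : iota x = tensor_lift (ht2 U) b (j (wtens x (wone F))).
  by rewrite (dr_j_tens dual) bE /b (dr_one dual) rmorph1 scale1r.
apply: in_hbar_linear => //; apply: hA => -[e1 e2] Ae.
rewrite /wtens /= mulrC; apply: (@in_hbarZ _ _ _ (wone F e2)); apply: hx.
by exists (e1, e2).
Qed.

Lemma j_tsum s : j (tsum s) = \sum_(q <- s) ht2 U (iota q.1) (iota q.2).
Proof. by rewrite linear_sum; apply: eq_bigr => q _; exact: dr_j_tens. Qed.

(** Both sides are continuous and agree on finite sums of tensors. *)
Lemma j_flip u : j (wflip u) = hflip (j u).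
Proof.
apply: (in_hbar_eq freeU2) => N; have [A [M [fA hA]]] := j_small N.
have [|s hs] := @tsum_dense _ _ u (A `|` (fun p => (p.2, p.1)) @` A).
  by rewrite finite_setU; split=> //; exact: finite_image.
rewrite -[u](subrK (tsum s)); move: (u - tsum s) hs => w hs.
have -> : wflip (w + tsum s) = wflip w + wflip (tsum s) by [].
have flips : j (wflip (tsum s)) = hflip (j (tsum s)).
  rewrite j_tsum linear_sum /tsum wflip_sum linear_sum; apply: eq_bigr => q _.
  by rewrite wflip_wtens !(dr_j_tens dual) /= hflip_tensor.
rewrite !linearD /= flips addrACA subrr addr0; apply: in_hbarB.
  apply: hA => -[e1 e2] Ae; rewrite /wflip hs; first exact: in_hbar0.
  by right; exists (e1, e2).
apply: in_hbar_linear; first exact: linearP.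
by apply: hA => p Ap; rewrite hs; [exact: in_hbar0|left].
Qed.

Lemma j_aug u : eps_l u = 0 -> eps_r u = 0 -> in_hbar 2 (j u).
Proof.
move=> ul ur; have [A [M [fA hA]]] := j_small 2.
have [s [hs us]] := tsum_dense_aug M fA ul ur.
rewrite -[u](subrK (tsum s)) linearD; apply: in_hbarD; first exact: hA.
rewrite j_tsum; apply: in_hbar_sum_seq => q /hs[e1 e2].
by apply: (tensor_in_hbar t2P (n := 1) (m := 1)); exact: iota_aug.
Qed.

(** The contraction (m o iota) (x) id, computed entry by entry; [slice_j] identifies it with the
    contraction by m in U (x) U. *)
Definition slice (m : hH U -> (hser k)^o) u : wF k F :=
  fun e => m (iota (fun e' => u (e', e))).

Lemma slice_j (m : hH U -> (hser k)^o) : linear m -> forall u,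
  iota (slice m u) = tensor_lift (ht2 U) (fun a b => m a *: b) (j u).
Proof.
move=> lm u; have hb : bilinear_map (fun a b : hH U => (m a : hser k) *: b).
  split=> [b a c c'|b a c c'] /=; first by rewrite lm scalerDl -scalerA.
  by rewrite scalerDr !scalerA mulrC.
have [lb bE] := tensor_liftP t2P freeU hb.
set T := tensor_lift _ _ in lb bE *.
have TD a b : T (a + b) = T a + T b by have := lb 1 a b; rewrite !scale1r.
have T0 : T 0 = 0 by have := lb (-1) 0 0; rewrite scaler0 addr0 scaleN1r addNr.
have sliceD v w : slice m (v + w) = slice m v + slice m w.
  apply/funext => e; rewrite /slice -[RHS]/(m (iota _) + m (iota _)).
  by have := lm 1; rewrite /= => lm1; rewrite -[m _ in RHS]scale1r -lm1 scale1r -linearD.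
have slice0 : slice m 0 = 0.
  apply/funext => e; rewrite /slice (_ : (fun e' => _) = 0) // linear0.
  by have := lm (-1) 0 0; rewrite scaler0 addr0 scaleN1r addNr.
have slice_wtens x y : slice m (wtens x y) = (m (iota x) : hser k) *: (y : wF k F).
  apply/funext => e; rewrite /slice.
  have -> : (fun e' => wtens x y (e', e)) = (y e : hser k) *: (x : wF k F).
    by apply/funext => e'; exact: mulrC.
  rewrite linearZZ; have := lm (y e) (iota x) 0; rewrite !addr0 => ->.
  have := lm (-1) 0 0; rewrite scaler0 addr0 scaleN1r addNr => ->.
  by rewrite addr0; exact: mulrC.
apply: (in_hbar_eq freeU) => N; have [A [M [fA hA]]] := j_small N.
(* D controls the outer [iota], and G the [iota] inside the slice, at the precision that D
   demands. *)
have [D [M1 [fD hD]]] := iota_small N; have [G [M2 [fG hG]]] := iota_small M1.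
have [|s hs] := @tsum_dense _ _ u (A `|` (G `*` D)).
  by rewrite finite_setU; split=> //; exact: finite_setX.
have sE : iota (slice m (tsum s)) = T (j (tsum s)).
  rewrite j_tsum (big_morph T TD T0) /tsum (big_morph (slice m) sliceD slice0).
  rewrite linear_sum; apply: eq_bigr => q _.
  by rewrite slice_wtens linearZZ bE.
rewrite -[u](subrK (tsum s)); move: (u - tsum s) hs => w hs.
rewrite linearD TD sliceD !linearD /= sE addrACA.
rewrite subrr addr0; apply: in_hbarB.
  apply: hD => e De; apply: (in_hbar_linear lm); apply: hG => e' Ge'.
  by rewrite hs; [exact: in_hbar0|right].
apply/(in_hbar_linear lb)/hA => p Ap.
by rewrite hs; [exact: in_hbar0|left].
Qed.

(** Every slice of u has image 0 under [iota], hence vanishes; linear forms on U then show that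
    [iota] kills every column of u. *)
Lemma j_inj u : j u = 0 -> u = 0.
Proof.
move=> ju; apply/funext => -[e' e].
suff x0 : (fun e' => u (e', e)) = 0 :> wF k F.
  exact: (congr1 (fun f : wF k F => f e') x0).
apply: iota_inj; apply: (in_hbar_eq0 freeU) => N; apply: contrapT => nx.
have [m [lm]] := dual_separates freeU nx; apply.
have : slice m u = 0.
  apply: iota_inj; rewrite slice_j // ju.
  have lT : linear (tensor_lift (ht2 U) (fun a b : hH U => (m a : hser k) *: b)).
    apply: (tensor_liftP t2P freeU _).1; split=> [b a c c'|b a c c'] /=.
      by rewrite lm scalerDl -scalerA.
    by rewrite scalerDr !scalerA mulrC.
  by have := lT (-1) 0 0; rewrite scaler0 addr0 scaleN1r addNr.
move/(congr1 (fun f : wF k F => f e)); rewrite /slice => ->.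
exact: in_hbar0.
Qed.

End DrinfeldDual.

(** * The classes in the tensor square of the cotangent Lie bialgebra *)

Section Independence.
Variables (k : fieldType) (F : wHopf k) (C : chart F) (U : hHopf k).
Variables (iota : {linear wF k F -> hH U}) (j : {linear wF2 k F -> hH2 U}).
Hypothesis dual : is_Drinfeld_dual iota j.
Local Notation I := 'I_(chart_dim C).
Implicit Types (x y : wring F) (a b : I).

Let freeU : topologically_free (hH U) := hfree U.
Let t2P := ht2P U.

Lemma jpow_eps n x : jpow n.+1 x -> eps x = 0.
Proof.
move: {-1}n.+1 (erefl n.+1) => m mn hx; elim: hx n mn => {m x} //.
- by move=> m n _; exact: eps0.
- by move=> m x y _ IHx _ IHy n mn; rewrite epsD (IHx n) // (IHy n) // addr0.
- by move=> m x y ex _ _ n _; rewrite epsM ex mul0r.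
Qed.

(** A representative in U of the basis vector of g given by the class of x_a. *)
Definition hvar a : hH U := hdiv 1 (iota (var a)).

Lemma hvarE a : hbar *: hvar a = iota (var a).
Proof. exact: (hdivK freeU (iota_aug dual (eps_var a))). Qed.

Definition lin_part x : hH U :=
  \sum_a hser_const (lin C a (modh x)) *: hvar a.

(** The nonlinear rest of x lies in hbar J + J^2, which [iota] sends into hbar^2 U. *)
Lemma hdiv_iota x : eps x = 0 -> in_hbar 1 (hdiv 1 (iota x) - lin_part x).
Proof.
move=> ex; apply: (in_hbar_cancel freeU (m := 1)).
rewrite scalerBr (hdivK freeU (iota_aug dual ex)).
have [x' [x'' [hx'' xE]]] := eps0_decomp C ex.
have ex' : eps x' = 0.
  have sum0 : eps (\sum_a hser_const (lin C a (modh x)) *: var a) = 0.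
    elim/big_ind: _ => [|y z ey ez|a _]; first exact: eps0.
      by rewrite epsD ey ez addr0.
    by rewrite epsZ eps_var mulr0.
  by apply: eps_hbar; rewrite -ex xE !epsD sum0 (jpow_eps hx'') addr0 add0r.
have -> : iota x - hbar ^+ 1 *: lin_part x = iota (hbar *: x' + x'' : wring F).
  rewrite {1}xE linearD linear_sum /lin_part scaler_sumr.
  rewrite [X in X + _ - _](eq_bigr (fun a =>
    hbar ^+ 1 *: (hser_const (lin C a (modh x)) *: hvar a))).
    by rewrite addrC addKr.
  by move=> a _; rewrite linearZZ -hvarE !scalerA mulrC.
rewrite linearD linearZZ; apply: in_hbarD; last exact: (iota_jpow dual hx'').
by apply: (@in_hbar_scale _ _ 1 1); exact: (iota_aug dual).
Qed.

(** A relation modulo hbar makes the image of the sum of the c_a X_a divisible by hbar^2; by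
    [iota_order] this sum then has no linear term. *)
Lemma hvar_free (c : I -> k) :
  in_hbar 1 (\sum_a hser_const (c a) *: hvar a) -> forall a, c a = 0.
Proof.
move=> h a; pose x : wring F := \sum_a hser_const (c a) *: var a.
have /(iota_order (C := C) dual)ordx : in_hbar 2 (iota x).
  have -> : iota x = hbar ^+ 1 *: (\sum_a hser_const (c a) *: hvar a).
    rewrite linear_sum scaler_sumr; apply: eq_bigr => b _.
    by rewrite linearZZ -hvarE !scalerA mulrC.
  exact: (@in_hbar_scale _ _ 1 1).
have := lin_order2 a ordx; rewrite /lin modh_sum tcoef_sum => <-.
rewrite (bigD1 a) //= modhZ modh_var tcoefZ -/(lin C a _) lin_var0 eqxx mulr1.
rewrite big1 ?addr0 // => b ba.
by rewrite modhZ modh_var tcoefZ -/(lin C a _) lin_var0 eq_sym (negPf ba) mulr0.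
Qed.

(** If, for some b, the combination of the first factors were nonzero modulo hbar, a form m would
    detect it; contracting by m gives a relation between the [hvar] alone. *)
Lemma hvar2_free (c : I -> I -> k) :
  in_hbar 1 (\sum_a \sum_b hser_const (c a b) *: ht2 U (hvar a) (hvar b)) ->
  forall a b, c a b = 0.
Proof.
move=> h a b; apply: (hvar_free (c := c^~ b)); apply: contrapT => nh.
have [m [lm]] := dual_separates freeU nh; apply.
have hb : bilinear_map (fun y z : hH U => (m y : hser k) *: z).
  split=> [z e y y'|y e z z'] /=; first by rewrite lm scalerDl -scalerA.
  by rewrite scalerDr !scalerA mulrC.
have [lT TE] := tensor_liftP t2P freeU hb.
pose mL : {linear hH U -> (hser k)^o} :=
  HB.pack m (GRing.isLinear.Build _ _ _ _ m lm).
set T := tensor_lift _ _ in lT TE.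
pose TL : {linear hH2 U -> hH U} := HB.pack T (GRing.isLinear.Build _ _ _ _ T lT).
pose y b := \sum_a hser_const (c a b) *: hvar a.
have : in_hbar 1 (\sum_b (m (y b) : hser k) *: hvar b).
  have -> : \sum_b (m (y b) : hser k) *: hvar b =
     TL (\sum_a \sum_b hser_const (c a b) *: ht2 U (hvar a) (hvar b)).
    rewrite exchange_big linear_sum; apply: eq_bigr => e _.
    rewrite -[m _]/(mL _) !linear_sum scaler_suml; apply: eq_bigr => e' _.
    by rewrite !linearZZ -scalerA; congr (_ *: _); rewrite [RHS]TE.
  exact: in_hbar_linear.
(* As for [hvar_free], but with coefficients in k[[hbar]], of which only the constant terms
   matter. *)
move=> hm; pose x : wring F := \sum_b (m (y b) : hser k) *: var b.
have /(iota_order (C := C) dual)ordx : in_hbar 2 (iota x).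
  have -> : iota x = hbar ^+ 1 *: (\sum_b (m (y b) : hser k) *: hvar b).
    rewrite linear_sum scaler_sumr; apply: eq_bigr => e _.
    by rewrite linearZZ -hvarE !scalerA mulrC.
  exact: (@in_hbar_scale _ _ 1 1).
apply/hser_in_hbarP => -[] // _.
have := lin_order2 b ordx; rewrite /lin modh_sum tcoef_sum => <-.
rewrite [RHS](bigD1 b) //= modhZ modh_var tcoefZ -/(lin C b _) lin_var0 eqxx mulr1.
rewrite [X in _ + X]big1 ?addr0 // => e be.
by rewrite modhZ modh_var tcoefZ -/(lin C b _) lin_var0 eq_sym (negPf be) mulr0.
Qed.

End Independence.

Section Bilinear.
Variables (k : fieldType) (F : wHopf k) (C : chart F).
Local Notation E := (wE F).
Local Notation I := 'I_(chart_dim C).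
Implicit Types (a b : I) (x : kprod k (E * E)) (y z : kprod k E).
Implicit Types (s : seq (kprod k E * kprod k E)).

Definition lin2 a b x : k :=
  lin C a ((fun e => lin C b (fun e' => x (e, e'))) : kprod k E).

Definition lin2_sum s a b : k := \sum_(q <- s) lin C a q.1 * lin C b q.2.

Lemma lin2D a b x x' : lin2 a b (x + x') = lin2 a b x + lin2 a b x'.
Proof.
rewrite /lin2 /lin -tcoefD; congr (tcoef _ _ _); apply/funext => e.
exact: (tcoefD (C := C) (mexp_unit b) (fun e' => x (e, e')) (fun e' => x' (e, e'))).
Qed.

Lemma lin2_0 a b : lin2 a b 0 = 0.
Proof. by apply: (addrI (lin2 a b 0)); rewrite -lin2D !addr0. Qed.

Lemma lin2_wtens a b y z : lin2 a b (wtens y z) = lin C a y * lin C b z.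
Proof.
rewrite /lin2 [RHS]mulrC /lin -tcoefZ; congr (tcoef _ _ _); apply/funext => e.
by rewrite [RHS]mulrC; exact: (tcoefZ (C := C) _ (y e) z).
Qed.

Definition ktsum s : kprod k (E * E) := \sum_(q <- s) wtens q.1 q.2.

Lemma lin2_ktsum a b s : lin2 a b (ktsum s) = lin2_sum s a b.
Proof.
rewrite /ktsum (big_morph (lin2 a b) (lin2D a b) (lin2_0 a b)).
by apply: eq_bigr => q _; exact: lin2_wtens.
Qed.

Lemma lin2_continuous : exists A : set (E * E), finite_set A /\
  forall x, (forall e, A e -> x e = 0) -> forall a b, lin2 a b x = 0.
Proof.
have /choice[A hA] a := tcoef_continuous (C := C) (mexp_unit a).
pose B := \bigcup_(a in [set: I]) A a; exists (B `*` B); split.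
  by apply: finite_setX; apply: bigcup_finite => // a _; case: (hA a).
move=> x hx a b; apply: (hA a).2 => e Ae; apply: (hA b).2 => e' Ae'.
by apply: hx; split; [exists a|exists b].
Qed.

Lemma lin2_deg3 x : max_ideal_deg3 F x -> forall a b, lin2 a b x = 0.
Proof.
have [A [fA hA]] := lin2_continuous.
move=> /(_ A fA)[s [hs xs]] a b.
have -> : x = (x - ktsum s) + ktsum s by rewrite subrK.
rewrite lin2D hA ?add0r => [|e Ae]; last first.
  by rewrite -[LHS]/(x e - ktsum s e) xs // subrr.
rewrite lin2_ktsum /lin2_sum big_seq big1 // => q /hs.
case=> -[h1 h2].
  by rewrite [lin C a _]lin_order2 ?mul0r //; exact/(max_ideal2E C).
by rewrite [lin C b _]lin_order2 ?mulr0 //; exact/(max_ideal2E C).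
Qed.

Section Value.
Variables (g gg : lmodType k) (p : {linear kprod k E -> g}) (tg : g -> g -> gg).
Hypothesis p_cot : is_cotangent p.
Hypothesis tg_tensor : is_tensor tg.

Lemma cotangent_lin y : max_ideal F y ->
  p y = \sum_a lin C a y *: p (var0 C a).
Proof.
move=> /(max_idealE C) hy; have h2 := order_ge1_lin hy.
have /(p_cot.2 _) [_] : max_ideal F (y - \sum_a lin C a y *: var0 C a).
  by apply/(max_idealE C); apply: order_geW h2.
move=> /(_ ((max_ideal2E C _).2 h2)) /eqP; rewrite linearB subr_eq0 => /eqP ->.
by rewrite linear_sum; apply: eq_bigr => a _; rewrite linearZZ.
Qed.

Lemma class_value s : (forall q, q \in s -> max_ideal F q.1 /\ max_ideal F q.2) ->
  \sum_(q <- s) tg (p q.1) (p q.2) =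
  \sum_a \sum_b lin2_sum s a b *: tg (p (var0 C a)) (p (var0 C b)).
Proof.
move=> hs; case: tg_tensor => -[tl tr] _.
pose tlL v : {linear g -> gg} :=
  HB.pack (tg^~ v) (GRing.isLinear.Build _ _ _ _ _ (tl v)).
pose trL v : {linear g -> gg} :=
  HB.pack (tg v) (GRing.isLinear.Build _ _ _ _ _ (tr v)).
transitivity (\sum_(q <- s) \sum_a \sum_b
  (lin C a q.1 * lin C b q.2) *: tg (p (var0 C a)) (p (var0 C b))).
  apply: eq_big_seq => q /hs[h1 h2]; rewrite (cotangent_lin h1).
  rewrite -[LHS]/(tlL _ _) linear_sum; apply: eq_bigr => a _.
  rewrite linearZZ -[tlL _ _]/(trL _ _) (cotangent_lin h2) linear_sum scaler_sumr.
  by apply: eq_bigr => b _; rewrite linearZZ scalerA.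
rewrite exchange_big; apply: eq_bigr => a _.
rewrite exchange_big; apply: eq_bigr => b _.
by rewrite -scaler_suml.
Qed.

End Value.

(** Write y (x) z as (y - l y) (x) z + l y (x) (z - l z) + l y (x) l z, with l the linear part; by
    hypothesis the last terms cancel in the sum. *)
Lemma deg3_split s : (forall q, q \in s -> max_ideal F q.1 /\ max_ideal F q.2) ->
  (forall a b, lin2_sum s a b = 0) ->
  exists s', (forall q, q \in s' -> (max_ideal2 F q.1 /\ max_ideal F q.2) \/
                                    (max_ideal F q.1 /\ max_ideal2 F q.2)) /\
    ktsum s = ktsum s'.
Proof.
move=> hs s0; pose l y : kprod k E := \sum_a lin C a y *: var0 C a.
have hl y : max_ideal F (l y).
  apply/(max_idealE C); rewrite /l; elim/big_ind: _ => [|u v|a _].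
  - exact: order_ge0.
  - exact: order_geD.
  - by apply: order_geZ; exact: var0_order.
have hl2 y : max_ideal F y -> max_ideal2 F (y - l y).
  by move=> /(max_idealE C) hy; apply/(max_ideal2E C); exact: order_ge1_lin.
exists ([seq (q.1 - l q.1, q.2) | q <- s] ++ [seq (l q.1, q.2 - l q.2) | q <- s]).
split.
  move=> q; rewrite mem_cat => /orP[] /mapP[r /hs[h1 h2] ->] /=.
    by left; split => //; exact: hl2.
  by right; split => //; exact: hl2.
have ktsumE t e : ktsum t e = \sum_(q <- t) (q.1 e.1 : k) * q.2 e.2.
  by rewrite /ktsum fct_sumE.
have ll0 e e' : \sum_(q <- s) (l q.1 e : k) * l q.2 e' = 0.
  transitivity (\sum_a \sum_b lin2_sum s a b * (var0 C a e * var0 C b e')); last first.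
    by rewrite big1 // => a _; rewrite big1 // => b _; rewrite s0 mul0r.
  transitivity (\sum_(q <- s) \sum_a \sum_b
     lin C a q.1 * lin C b q.2 * (var0 C a e * var0 C b e')).
    apply: eq_bigr => q _; rewrite /l !fct_sumE mulr_suml.
    apply: eq_bigr => a _; rewrite mulr_sumr; apply: eq_bigr => b _.
    by rewrite -[LHS]mulrACA.
  rewrite exchange_big; apply: eq_bigr => a _.
  by rewrite exchange_big; apply: eq_bigr => b _; rewrite mulr_suml.
apply/funext => e; rewrite !ktsumE big_cat /= !big_map.
transitivity (\sum_(q <- s) ((q.1 e.1 - l q.1 e.1 : k) * q.2 e.2 +
    l q.1 e.1 * (q.2 e.2 - l q.2 e.2 : k) + l q.1 e.1 * l q.2 e.2)).
  by apply: eq_bigr => q _; rewrite mulrBl mulrBr addrA subrK subrK.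
by rewrite !big_split /= ll0 addr0.
Qed.

End Bilinear.

Section Classes.
Variables (k : fieldType) (F : wHopf k) (C : chart F) (U : hHopf k).
Variables (iota : {linear wF k F -> hH U}) (j : {linear wF2 k F -> hH2 U}).
Hypothesis dual : is_Drinfeld_dual iota j.
Variables (g gg : lmodType k) (p : {linear kprod k (wE F) -> g}).
Variable tg : g -> g -> gg.
Hypotheses (p_cot : is_cotangent p) (tg_tensor : is_tensor tg).
Local Notation E := (wE F).
Local Notation I := 'I_(chart_dim C).

Let freeU : topologically_free (hH U) := hfree U.
Let freeU2 : topologically_free (hH2 U) := hfree2 U.
Let t2P := ht2P U.

Definition modh2 (s : seq (wF k F * wF k F)) :=
  [seq (modh q.1, modh q.2) | q <- s].

Lemma modh_tsum s : modh (tsum s) = ktsum (modh2 s).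
Proof.
by rewrite /tsum modh_sum /ktsum big_map; apply: eq_bigr => q _; exact: modh_wtens.
Qed.

Lemma modh2_max (s : seq (wF k F * wF k F)) :
  (forall q, q \in s -> wcou F q.1 = 0 /\ wcou F q.2 = 0) ->
  forall q, q \in modh2 s -> max_ideal F q.1 /\ max_ideal F q.2.
Proof.
move=> hs q /mapP[r /hs[e1 e2] ->].
by split; apply/(max_idealE C); exact: eps_order.
Qed.

(** Converse of [lin2_deg3]: an approximation of w in J (x) J that is good on B also has vanishing
    linear coefficients, so [deg3_split] applies to it. *)
Lemma deg3_of_lin2 (w : wF2 k F) : eps_l w = 0 -> eps_r w = 0 ->
  (forall a b : I, lin2 a b (modh w) = 0) -> max_ideal_deg3 F (modh w).
Proof.
move=> wl wr w0 A fA; have [B [fB hB]] := lin2_continuous C.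
have [|s [hs ws]] := @tsum_dense_aug _ _ w (A `|` B) 1 _ wl wr.
  by rewrite finite_setU.
have lin0 (a b : I) : lin2_sum (modh2 s) a b = 0 :> k.
  rewrite -lin2_ktsum -modh_tsum -(w0 a b) -[in RHS](subrK (tsum s) w) modhD lin2D.
  rewrite [X in X + _]hB ?add0r // => e Be.
  by apply: ((modh_small _ _).1 ws); right.
have [s' [hs' ss']] := deg3_split (modh2_max hs) lin0.
exists s'; split=> // e Ae.
rewrite -[\sum_(q <- s') _]/(ktsum s') -ss' -modh_tsum.
rewrite -[in LHS](subrK (tsum s) w) modhD.
rewrite -[LHS]/(modh (w - tsum s) e + modh (tsum s) e).
by rewrite ((modh_small _ _).1 ws) ?add0r //; left.
Qed.

Lemma hdiv_tsum (s : seq (wF k F * wF k F)) :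
  (forall q, q \in s -> wcou F q.1 = 0 /\ wcou F q.2 = 0) ->
  in_hbar 1 (\sum_(q <- s) ht2 U (hdiv 1 (iota q.1)) (hdiv 1 (iota q.2)) -
    \sum_(a : I) \sum_(b : I) hser_const (lin2_sum (modh2 s) a b) *:
      ht2 U (hvar iota a) (hvar iota b)).
Proof.
move=> hs.
have -> : \sum_(a : I) \sum_(b : I) hser_const (lin2_sum (modh2 s) a b) *:
      ht2 U (hvar iota a) (hvar iota b) =
   \sum_(q <- s) ht2 U (lin_part C iota (q.1 : wring F))
                       (lin_part C iota (q.2 : wring F)).
  transitivity (\sum_(q <- s) \sum_(a : I) \sum_(b : I)
    hser_const (lin C a (modh q.1) * lin C b (modh q.2)) *:
      ht2 U (hvar iota a) (hvar iota b)); last first.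
    apply: eq_bigr => q _; rewrite (tensor_suml t2P); apply: eq_bigr => a _.
    rewrite (tensorZl t2P) (tensor_sumr t2P) scaler_sumr; apply: eq_bigr => b _.
    by rewrite (tensorZr t2P) rmorphM scalerA.
  rewrite [RHS]exchange_big; apply: eq_bigr => a _.
  rewrite [RHS]exchange_big; apply: eq_bigr => b _.
  by rewrite -scaler_suml /lin2_sum big_map rmorph_sum.
rewrite -sumrB; apply: in_hbar_sum_seq => q /hs[e1 e2].
set x := hdiv _ _; set y := hdiv _ _; set x' := lin_part _ _ _.
set y' := lin_part _ _ _.
have -> : ht2 U x y - ht2 U x' y' = ht2 U (x - x') y + ht2 U x' (y - y').
  by rewrite (tensorBl t2P) (tensorBr t2P) addrA subrK.
apply: in_hbarD.
  by apply: (tensor_in_hbar t2P (n := 1) (m := 0));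
    [exact: (hdiv_iota C dual e1)|exact: in_hbar00].
by apply: (tensor_in_hbar t2P (n := 0) (m := 1));
  [exact: in_hbar00|exact: (hdiv_iota C dual e2)].
Qed.

(** A single sum of tensors in J (x) J, close to u, computes both classes; any other representative
    of either class has the same matrix of linear coefficients. *)
Lemma common_class (u : wF2 k F) (v : hH2 U) :
  eps_l u = 0 -> eps_r u = 0 -> hbar ^+ 2 *: v = j u ->
  exists c : gg,
    (forall c', is_class_mod_deg3 p tg (modh u) c' <-> c' = c) /\
    (forall c', is_class_modh iota p tg v c' <-> c' = c).
Proof.
(* Precision hbar^3, since v is hbar^-2 j u and is needed modulo hbar. *)
move=> ul ur vE; have [A [M [fA hA]]] := j_small dual 3.
have [B [fB hB]] := lin2_continuous C.
have [|s [hs us]] := @tsum_dense_aug _ _ u (A `|` B) (maxn M 1) _ ul ur.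
  by rewrite finite_setU.
have hs2 := modh2_max hs.
set w := u - tsum s in us.
have uE : u = w + tsum s by rewrite /w subrK.
have w0 (a b : I) : lin2 a b (modh w) = 0.
  apply: hB => e Be; apply: ((modh_small B _).1 _) => //.
  by apply: smallW us; [exact: leq_maxr|move=> e' Be'; right].
have jw : in_hbar 3 (j w).
  by apply: hA; apply: smallW us; [exact: leq_maxl|move=> e' Ae'; left].
have lin_u (a b : I) : lin2 a b (modh u) = lin2_sum (modh2 s) a b.
  by rewrite uE modhD lin2D w0 add0r modh_tsum lin2_ktsum.
have vs : in_hbar 1 (v - \sum_(q <- s) ht2 U (hdiv 1 (iota q.1)) (hdiv 1 (iota q.2))).
  apply: (in_hbar_cancel freeU2 (m := 2)); rewrite scalerBr vE scaler_sumr.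
  have -> : \sum_(q <- s) hbar ^+ 2 *: ht2 U (hdiv 1 (iota q.1)) (hdiv 1 (iota q.2))
     = j (tsum s).
    rewrite (j_tsum dual); apply: eq_big_seq => q /hs[e1 e2].
    rewrite -[in RHS](hdivK freeU (iota_aug dual e1)).
    rewrite -[in RHS](hdivK freeU (iota_aug dual e2)).
    by rewrite (tensorZl t2P) (tensorZr t2P) scalerA.
  by rewrite -linearB.
pose c := \sum_(q <- modh2 s) tg (p q.1) (p q.2).
exists c; split=> c'; split.
- move=> [s' [hs' -> hdeg]]; rewrite /c !(class_value C p_cot tg_tensor) //.
  apply: eq_bigr => a _; apply: eq_bigr => b _; congr (_ *: _).
  rewrite -lin_u -lin2_ktsum -[in RHS](subrK (ktsum s') (modh u)) lin2D.
  by rewrite [X in X + _](lin2_deg3 hdeg) add0r.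
- move=> ->; exists (modh2 s); split=> //.
  rewrite -[\sum_(q <- _) wtens _ _]/(ktsum (modh2 s)) -modh_tsum -modhB.
  apply: deg3_of_lin2; last exact: w0.
    by rewrite eps_lB ul eps_l_tsum ?subrr // => q /hs[].
  by rewrite eps_rB ur eps_r_tsum ?subrr // => q /hs[].
- move=> [s' [hs' -> hv]].
  have hs2' := modh2_max hs'.
  rewrite -[LHS](big_map (fun q : wF k F * wF k F => (modh q.1, modh q.2)) xpredT
    (fun q => tg (p q.1) (p q.2))).
  rewrite /c !(class_value C p_cot tg_tensor) //.
  apply: eq_bigr => a _; apply: eq_bigr => b _; congr (_ *: _).
  apply/eqP; rewrite -subr_eq0; apply/eqP; move: a b.
  pose L t : hH2 U := \sum_(a : I) \sum_(b : I)
    hser_const (lin2_sum (modh2 t) a b) *: ht2 U (hvar iota a) (hvar iota b).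
  pose l (a b : I) := lin2_sum (modh2 s') a b - lin2_sum (modh2 s) a b.
  apply: (hvar2_free dual (c := l)).
  have -> : \sum_(a : I) \sum_(b : I)
      hser_const (l a b) *: ht2 U (hvar iota a) (hvar iota b) = L s' - L s.
    rewrite -sumrB; apply: eq_bigr => a _; rewrite -sumrB; apply: eq_bigr => b _.
    by rewrite raddfB scalerBl.
  apply: in_hbarB_trans (in_hbarBC (hdiv_tsum hs')) _.
  apply: in_hbarB_trans _ (hdiv_tsum hs).
  exact: in_hbarB_trans (in_hbarBC hv) vs.
- move=> ->; exists s; split=> //.
  by rewrite /c /modh2 big_map.
Qed.

End Classes.

Theorem theorem4p2p2 (k : fieldType) (char0 : [pchar k] =i pred0)
  (F : wHopf k) (F_QFSHA : is_QFSHA F)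
  (U : hHopf k) (iota : {linear wF k F -> hH U}) (j : {linear wF2 k F -> hH2 U})
  (U_dual : is_Drinfeld_dual iota j)
  (g : lmodType k) (p : {linear kprod k (wE F) -> g})
  (g_cotangent : is_cotangent p)
  (gg : lmodType k) (tg : g -> g -> gg) (gg_tensor : is_tensor tg)
  (phi : wF2 k F) (phi_polar : is_polar_twist j phi) :
  let Fc : hH2 U := polar_exp j phi in
  let phiv : hH2 U := hdiv 1 (hlog Fc) in
  let phi_a : wF2 k F := phi - wflip phi in
  let phiv_a : hH2 U := phiv - hflip phiv in
  [/\ hbar ^+ 2 *: phiv = j phi,
      (wflip phi = - phi <-> is_inverse (hflip Fc) Fc) /\
      (is_inverse (hflip Fc) Fc <-> hflip phiv = - phiv),
      Fc = hexp (hbar *: phiv) /\ is_twist Fc &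
      exists c : gg,
        (forall c', is_class_mod_deg3 p tg (modh phi_a) c' <-> c' = c) /\
        (forall c', is_class_modh iota p tg phiv_a c' <-> c' = c)].
Proof.
move=> Fc phiv phi_a phiv_a.
have [C] := QFSHA_chart F_QFSHA.
have freeU2 : topologically_free (hH2 U) := hfree2 U.
have [phi_r phi_l twist] := phi_polar.
have phi_r0 : eps_r phi = 0 by apply/funext.
have phi_l0 : eps_l phi = 0 by apply/funext.
(* psi is hbar^-2 j phi and will be phi^vee; the exponent hbar^-1 phi is hbar psi, so exp and log
   converge. *)
have [psi psiE] := j_aug U_dual phi_l0 phi_r0.
have FcE : Fc = hexp (hbar *: psi).
  by rewrite /Fc /polar_exp (hdivE freeU2 (y := hbar *: psi)) // scalerA.
have h1 (v : hH2 U) : in_hbar 1 (hbar *: v) by exists v.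
have phivE : phiv = psi.
  by rewrite /phiv FcE (hexpK char0 freeU2 (h1 psi)) (hdivE freeU2 (y := psi)).
have flip_exp : hflip Fc = hexp (hbar *: hflip psi).
  rewrite FcE (hexp_morph (f := @hflip k U)) ?linearZ //.
  - exact: hflip_linear.
  - exact: hflip1.
  - exact: hflipM.
have exp_inv : is_inverse (hexp (- (hbar *: psi))) Fc.
  rewrite FcE; split; last exact: hexpN.
  by rewrite -[in X in _ * X](opprK (hbar *: psi)); apply: hexpN => //; exact: in_hbarN.
have inv_flip : is_inverse (hflip Fc) Fc <-> hflip phiv = - phiv.
  rewrite phivE; split=> [[_ inv]|flip].
    (* Both are inverse to the twist; taking logarithms and cancelling hbar gives antisymmetry. *)
    have : hexp (hbar *: hflip psi) = hexp (- (hbar *: psi)).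
      by rewrite -flip_exp -[LHS]mul1r -exp_inv.1 -mulrA inv mulr1.
    move/(congr1 (@hlog _ _)); rewrite !(hexpK char0 freeU2) ?in_hbarN //.
      by rewrite -scalerN; exact: hbar1_inj.
    exact: in_hbarN.
  by rewrite flip_exp flip scalerN.
split.
- by rewrite phivE.
- split=> //; rewrite inv_flip phivE; split=> flip.
    apply: (hbar_inj freeU2 (N := 2)).
    by rewrite -linearZZ scalerN -psiE /= -(j_flip U_dual) flip linearN.
  apply/eqP; rewrite -subr_eq0 opprK; apply/eqP; apply: (j_inj C U_dual).
  by rewrite linearD (j_flip U_dual) psiE linearZZ /= flip scalerN addNr.
- by rewrite phivE -FcE.
- apply: (common_class C U_dual g_cotangent gg_tensor).
  + by rewrite /phi_a eps_lB eps_l_flip phi_l0 phi_r0 subrr.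
  + by rewrite /phi_a eps_rB eps_r_flip phi_l0 phi_r0 subrr.
  + by rewrite /phiv_a phivE scalerBr -linearZZ -psiE /= -(j_flip U_dual) -linearB.
Qed.
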